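(* Let $N,n,m,L\ge 1$ be integers, $\mathbf{A}\in\mathbb{R}^{n\times N}$ a fixed matrix, $\tau,\lambda>0$ with $\tau\|\mathbf{A}\|_{2\to2}^2\le 1$, and let $B_{\mathrm{in}}=B_{\mathrm{out}}>0$. Let $\mathbf{x}_1,\dots,\mathbf{x}_m$ be drawn i.i.d. at random according to some (unknown) probability distribution on $\mathbb{R}^N$ such that $\|\mathbf{x}_i\|_2\le B_{\mathrm{in}}$ almost surely, and let $\mathbf{y}_i=\mathbf{A}\mathbf{x}_i$. Let $\mathcal{H}_1^L$ be the hypothesis space of thresholding networks $\mathbf{y}\mapsto\sigma(\mathbf{\Phi}f_{\mathbf{\Phi}}^L(\mathbf{y}))$, $\mathbf{\Phi}\in O(N)$. Then for every $\delta\in(0,1)$, with probability at least $1-\delta$ over the samples, for all $h\in\mathcal{H}_1^L$, $$\mathcal{L}(h)\le\hat{\mathcal{L}}(h)+8B_{\mathrm{out}}\sqrt{\frac{Nn\log(2+8L(L+3))}{m}}+8B_{\mathrm{out}}\frac{N\sqrt{\log(e+8eL)}}{\sqrt{m}}+B_{\mathrm{out}}\sqrt{\frac{128\log(4/\delta)}{m}}.$$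
   Context: $O(N)$ is the orthogonal group of $N\times N$ real matrices; $\|\cdot\|_{2\to2}$ is the spectral norm. Soft thresholding: $S_{\mu}(x)=\operatorname{sign}(x)\max(0,|x|-\mu)$ for $x\in\mathbb{R}$, applied entrywise to vectors. Thresholding network: for $\mathbf{\Phi}\in O(N)$ and $\mathbf{y}\in\mathbb{R}^n$, $f_{\mathbf{\Phi}}^1(\mathbf{y})=S_{\tau\lambda}\bigl(\tau(\mathbf{A}\mathbf{\Phi})^\top\mathbf{y}\bigr)$ and, for $l\ge2$, $f_{\mathbf{\Phi}}^l(\mathbf{y})=S_{\tau\lambda}\bigl[(\mathbf{I}-\tau\mathbf{\Phi}^\top\mathbf{A}^\top\mathbf{A}\mathbf{\Phi})f_{\mathbf{\Phi}}^{l-1}(\mathbf{y})+\tau(\mathbf{A}\mathbf{\Phi})^\top\mathbf{y}\bigr]$. The map $\sigma:\mathbb{R}^N\to\mathbb{R}^N$ is $\sigma(\mathbf{x})=\mathbf{x}$ if $\|\mathbf{x}\|_2\le B_{\mathrm{out}}$ and $\sigma(\mathbf{x})=B_{\mathrm{out}}\mathbf{x}/\|\mathbf{x}\|_2$ otherwise. Hypothesis space: $\mathcal{H}_1^L=\{\mathbf{y}\mapsto\sigma(\mathbf{\Phi}f_{\mathbf{\Phi}}^L(\mathbf{y})):\mathbf{\Phi}\in O(N)\}$, a set of functions $\mathbb{R}^n\to\mathbb{R}^N$. Loss: $\ell(h,\mathbf{x},\mathbf{y})=\|h(\mathbf{y})-\mathbf{x}\|_2$. Empirical loss: $\hat{\mathcal{L}}(h)=\frac1m\sum_{j=1}^m\ell(h,\mathbf{x}_j,\mathbf{y}_j)$.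 True loss: $\mathcal{L}(h)=\mathbb{E}\,\ell(h,\mathbf{x},\mathbf{y})$, where $\mathbf{x}$ has the sampling distribution and $\mathbf{y}=\mathbf{A}\mathbf{x}$. *)

(* Defs.v *)
From HB Require Import structures.
From mathcomp Require Import all_boot all_order all_algebra.
From mathcomp Require Import all_classical all_reals all_analysis.

Set Implicit Arguments.
Unset Strict Implicit.
Unset Printing Implicit Defensive.

Import Order.TTheory GRing.Theory Num.Theory.
Import numFieldNormedType.Exports.

Local Open Scope classical_set_scope.
Local Open Scope ring_scope.

(* The library norm `|v| on matrices is the max norm, hence this definition. *)
Definition l2norm (R : realType) (k : nat) (v : 'cV[R]_k) : R :=
  Num.sqrt (\sum_(i < k) v i 0 ^+ 2).

Definition spectral_norm (R : realType) (n N : nat) (A : 'M[R]_(n, N)) : R :=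
  sup [set l2norm (A *m v) | v in [set v : 'cV[R]_N | l2norm v <= 1]].

Definition orthogonal_group (R : realType) (N : nat) : set 'M[R]_N :=
  [set Phi | Phi^T *m Phi = 1%:M].
Arguments orthogonal_group : clear implicits.

Definition soft (R : realType) (mu x : R) : R :=
  Num.sg x * Num.max 0 (`|x| - mu).

Definition softv (R : realType) (k : nat) (mu : R) (v : 'cV[R]_k) : 'cV[R]_k :=
  map_mx (soft mu) v.

(* The network f_Phi^l has l >= 1 layers; the value at l = 0 is a dummy. *)
Fixpoint thresholding_net (R : realType) (n N : nat) (A : 'M[R]_(n, N))
    (tau lambda : R) (Phi : 'M[R]_N) (l : nat) (y : 'cV[R]_n) : 'cV[R]_N :=
  match l with
  | 0 => 0
  | 1 => softv (tau * lambda) (tau *: ((A *m Phi)^T *m y))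
  | l'.+1 =>
      softv (tau * lambda)
        ((1%:M - tau *: (Phi^T *m A^T *m A *m Phi)) *m
           thresholding_net A tau lambda Phi l' y
         + tau *: ((A *m Phi)^T *m y))
  end.

Definition ball_proj (R : realType) (N : nat) (B : R) (x : 'cV[R]_N) :
    'cV[R]_N :=
  if l2norm x <= B then x else (B / l2norm x) *: x.

Definition hypothesis_space (R : realType) (n N : nat) (A : 'M[R]_(n, N))
    (tau lambda Bout : R) (L : nat) : set ('cV[R]_n -> 'cV[R]_N) :=
  [set (fun y => ball_proj Bout (Phi *m thresholding_net A tau lambda Phi L y))
     | Phi in orthogonal_group R N].

Definition loss (R : realType) (n N : nat) (h : 'cV[R]_n -> 'cV[R]_N)
    (x : 'cV[R]_N) (y : 'cV[R]_n) : R :=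
  l2norm (h y - x).

Definition empirical_loss (R : realType) (n N m : nat)
    (x : 'I_m -> 'cV[R]_N) (y : 'I_m -> 'cV[R]_n)
    (h : 'cV[R]_n -> 'cV[R]_N) : R :=
  m%:R^-1 * \sum_(j < m) loss h (x j) (y j).

(* R^N with its Borel sigma-algebra; the carrier is convertible to 'cV[R]_N. *)
Notation borel_cV R N := (g_sigma_algebraType (@open 'cV[R]_N)).

Definition true_loss (R : realType) (n N : nat) (A : 'M[R]_(n, N))
    (D : probability (borel_cV R N) R) (h : 'cV[R]_n -> 'cV[R]_N) : \bar R :=
  ('E_D [fun x : 'cV[R]_N => loss h x (A *m x)])%E.

Definition mutually_independent (R : realType)
    (d d' : measure_display) (T : measurableType d) (E : measurableType d')
    (P : probability T R) (m : nat) (X : 'I_m -> {RV P >-> E}) : Prop :=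
  forall (J : {set 'I_m}) (B : 'I_m -> set E),
    (forall i, measurable (B i)) ->
    P (\bigcap_(i in [set` J]) (X i @^-1` B i)) =
      (\prod_(i in J) P (X i @^-1` B i))%E.

Definition iid_sample (R : realType)
    (d d' : measure_display) (T : measurableType d) (E : measurableType d')
    (P : probability T R) (D : probability E R)
    (m : nat) (X : 'I_m -> {RV P >-> E}) : Prop :=
  (forall i (B : set E), measurable B -> distribution P (X i) B = D B) /\
  mutually_independent X.

(* Main.v *)
Require Import Defs.
From HB Require Import structures.
From mathcomp Require Import all_boot all_order all_algebra.
From mathcomp Require Import all_classical all_reals all_analysis.
From mathcomp Require Import measurable_realfun ring lra.

(** The loss of the network with basis [Phi] at a signal [x] is a random process
    indexed by the orthogonal group, and the theorem bounds the supremum of its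
    centred empirical average by chaining.

    Stability.  In the signal domain a layer is a gradient step independent of
    [Phi] followed by the thresholding [Phi S Phi^T].  Both halves are
    nonexpansive under the step size condition, so perturbing [Phi] in each of
    the [L] layers costs in total at most [L * (L + 1) * |x|] times the spectral
    distance of the bases ([synthesis_lipschitz_basis]).  For signals in the ball
    of radius [B] this is a uniform Lipschitz bound for the loss in [Phi].

    Entropy.  The spectral unit ball of [N] by [N] matrices, and hence the
    orthogonal group, has nets of scale [eps] with at most
    [(1 + 3 / eps) ^ (N ^ 2)] elements ([packing_card], [finite_net]).  It matters
    that [N] occurs only in the exponent, since the bound to be proved has no
    logarithm of [N].

    Concentration.  For one fixed function with values in an interval of length
    [c], the empirical average falls below the mean by [t] with probability at
    most [exp (- m t ^ 2 / (4 c ^ 2))] ([deviation_inequality]).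

    Chaining.  A union bound over one net would leave a factor [ln m].  Instead
    a coarse net is used for the losses themselves, and ever finer nets for the
    differences of losses of neighbouring bases, whose ranges decrease
    geometrically ([chaining_bound]).  Starting at scale [B / 16], the whole chain
    costs [5 * B * sqrt ((N ^ 2 * ln (1 + 48 * L * (L + 1)) + ln (2 / delta)) / m)],
    and this is below the sum of the last two terms of the claimed bound
    ([numeric_bound]).

    Measurability of the good event holds because the nets exhaust a countable
    dense set of bases and both losses depend continuously on the basis. *)

Import Order.TTheory GRing.Theory Num.Theory.
Import numFieldNormedType.Exports.

Local Open Scope classical_set_scope.
Local Open Scope ring_scope.

Set Implicit Arguments.
Unset Strict Implicit.
Unset Printing Implicit Defensive.

(** * Euclidean geometry of column vectors *)

Definition dotp (R : realType) (k : nat) (u v : 'cV[R]_k) : R :=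
  \sum_(i < k) u i 0 * v i 0.

Section Euclid.
Variable R : realType.
Implicit Types k : nat.

Lemma dotpC k (u v : 'cV[R]_k) : dotp u v = dotp v u.
Proof. by apply: eq_bigr => i _; rewrite mulrC. Qed.

Lemma dotpDl k (u v w : 'cV[R]_k) :
  dotp (u + v) w = dotp u w + dotp v w.
Proof. by rewrite /dotp -big_split /=; apply: eq_bigr => i _; rewrite mxE mulrDl. Qed.

Lemma dotpZl k (a : R) (u v : 'cV[R]_k) :
  dotp (a *: u) v = a * dotp u v.
Proof. by rewrite /dotp mulr_sumr; apply: eq_bigr => i _; rewrite mxE mulrA. Qed.

Lemma dotpNl k (u v : 'cV[R]_k) : dotp (- u) v = - dotp u v.
Proof. by rewrite -scaleN1r dotpZl mulN1r. Qed.

Lemma dotpBl k (u v w : 'cV[R]_k) :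
  dotp (u - v) w = dotp u w - dotp v w.
Proof. by rewrite dotpDl dotpNl. Qed.

Lemma dotpDr k (u v w : 'cV[R]_k) :
  dotp w (u + v) = dotp w u + dotp w v.
Proof. by rewrite dotpC dotpDl !(dotpC _ w). Qed.

Lemma dotpZr k (a : R) (u v : 'cV[R]_k) :
  dotp v (a *: u) = a * dotp v u.
Proof. by rewrite dotpC dotpZl dotpC. Qed.

Lemma dotpNr k (u v : 'cV[R]_k) : dotp v (- u) = - dotp v u.
Proof. by rewrite -scaleN1r dotpZr mulN1r. Qed.

Lemma dotpBr k (u v w : 'cV[R]_k) :
  dotp w (u - v) = dotp w u - dotp w v.
Proof. by rewrite dotpDr dotpNr. Qed.

Lemma dotp_mulmx k l (A : 'M[R]_(k, l)) u v :
  dotp (A *m u) v = dotp u (A^T *m v).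
Proof.
have E p (a b : 'cV[R]_p) : dotp a b = (a^T *m b) 0 0.
  by rewrite mxE; apply: eq_bigr => i _; rewrite mxE.
by rewrite !E trmx_mul mulmxA.
Qed.

Lemma dotpp_ge0 k (u : 'cV[R]_k) : 0 <= dotp u u.
Proof. by apply: sumr_ge0 => i _; rewrite -expr2 sqr_ge0. Qed.

Lemma l2norm_ge0 k (u : 'cV[R]_k) : 0 <= l2norm u.
Proof. exact: sqrtr_ge0. Qed.

Lemma l2norm_sqr k (u : 'cV[R]_k) : l2norm u ^+ 2 = dotp u u.
Proof.
have E : \sum_(i < k) u i 0 ^+ 2 = dotp u u.
  by apply: eq_bigr => i _; rewrite expr2.
by rewrite /l2norm E sqr_sqrtr // dotpp_ge0.
Qed.

Lemma cauchy_schwarz k (u v : 'cV[R]_k) : dotp u v <= l2norm u * l2norm v.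
Proof.
have [v0|v0] := eqVneq (l2norm v) 0.
  have vi i : v i 0 = 0.
    apply/eqP; rewrite -sqrf_eq0; have := l2norm_sqr v.
    rewrite v0 expr0n /= => /esym/eqP; rewrite /dotp psumr_eq0; last first.
      by move=> j _; rewrite -expr2 sqr_ge0.
    by move=> /allP/(_ i); rewrite mem_index_enum expr2; apply.
  by rewrite v0 mulr0 /dotp big1 // => i _; rewrite vi mulr0.
have [u0|u0] := eqVneq (l2norm u) 0.
  have ui i : u i 0 = 0.
    apply/eqP; rewrite -sqrf_eq0; have := l2norm_sqr u.
    rewrite u0 expr0n /= => /esym/eqP; rewrite /dotp psumr_eq0; last first.
      by move=> j _; rewrite -expr2 sqr_ge0.
    by move=> /allP/(_ i); rewrite mem_index_enum expr2; apply.
  by rewrite u0 mul0r /dotp big1 // => i _; rewrite ui mul0r.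
have up : 0 < l2norm u by rewrite lt_neqAle eq_sym u0 l2norm_ge0.
have vp : 0 < l2norm v by rewrite lt_neqAle eq_sym v0 l2norm_ge0.
(* Expanding the square of this vector gives the inequality. *)
have := dotpp_ge0 (l2norm v *: u - l2norm u *: v).
rewrite dotpBl !dotpBr !dotpZl !dotpZr -!l2norm_sqr (dotpC v u).
have uvp : 0 < l2norm u * l2norm v by rewrite mulr_gt0.
move: (l2norm u) (l2norm v) (dotp u v) up vp uvp => a b c ap bp abp h.
have : 0 <= (a * b) * (a * b - c) by lra.
by rewrite pmulr_rge0 // subr_ge0.
Qed.

Lemma l2normD k (u v : 'cV[R]_k) : l2norm (u + v) <= l2norm u + l2norm v.
Proof.
rewrite -(ler_pXn2r (n := 2)) ?nnegrE ?addr_ge0 ?l2norm_ge0 //.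
rewrite l2norm_sqr dotpDl !dotpDr -!l2norm_sqr (dotpC v u).
have := cauchy_schwarz u v; lra.
Qed.

Lemma l2normZ k (a : R) (u : 'cV[R]_k) : l2norm (a *: u) = `|a| * l2norm u.
Proof.
apply/eqP; rewrite -(eqrXn2 (n := 2)) ?mulr_ge0 ?l2norm_ge0 //.
by rewrite exprMn !l2norm_sqr dotpZl dotpZr mulrA real_normK ?num_real.
Qed.

Lemma l2normN k (u : 'cV[R]_k) : l2norm (- u) = l2norm u.
Proof. by rewrite -scaleN1r l2normZ normrN1 mul1r. Qed.

Lemma l2normB k (u v : 'cV[R]_k) : l2norm (u - v) <= l2norm u + l2norm v.
Proof. by rewrite -(l2normN v) l2normD. Qed.

Lemma l2norm_distC k (u v : 'cV[R]_k) : l2norm (u - v) = l2norm (v - u).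
Proof. by rewrite -opprB l2normN. Qed.

Lemma l2norm0 k : l2norm (0 : 'cV[R]_k) = 0.
Proof. by rewrite -(scale0r 0) l2normZ normr0 mul0r. Qed.

Lemma l2norm_dist_dist k (u v : 'cV[R]_k) :
  `|l2norm u - l2norm v| <= l2norm (u - v).
Proof.
have h (a b : 'cV[R]_k) : l2norm a <= l2norm (a - b) + l2norm b.
  by rewrite -{1}(subrK b a) l2normD.
by rewrite ler_norml; have := h u v; have := h v u; rewrite (l2norm_distC v); lra.
Qed.

Lemma ler_l2norm k (u v : 'cV[R]_k) :
  (forall i, `|u i 0| <= `|v i 0|) -> l2norm u <= l2norm v.
Proof.
move=> h; apply: ler_wsqrtr; apply: ler_sum => i _.
by rewrite -real_normK ?num_real // -(real_normK (num_real (v i 0))) lerXn2r ?nnegrE.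
Qed.

Lemma l2norm_le_sum k (u : 'cV[R]_k) : l2norm u <= \sum_(i < k) `|u i 0|.
Proof.
rewrite -(ler_pXn2r (n := 2)) ?nnegrE ?sumr_ge0 ?l2norm_ge0 //.
rewrite l2norm_sqr /dotp [leRHS]expr2 mulr_suml; apply: ler_sum => i _.
rewrite -expr2 -real_normK ?num_real // expr2 ler_wpM2l //.
by rewrite (bigD1 i) //= lerDl sumr_ge0.
Qed.

Lemma abs_le_l2norm k (u : 'cV[R]_k) i : `|u i 0| <= l2norm u.
Proof.
rewrite -(ler_pXn2r (n := 2)) ?nnegrE ?l2norm_ge0 //.
rewrite l2norm_sqr /dotp (bigD1 i) //= real_normK ?num_real // expr2 lerDl.
by apply: sumr_ge0 => j _; rewrite -expr2 sqr_ge0.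
Qed.

Lemma l2norm_orthogonal k (U : 'M[R]_k) v :
  U^T *m U = 1%:M -> l2norm (U *m v) = l2norm v.
Proof.
move=> hU; apply/eqP; rewrite -(eqrXn2 (n := 2)) ?l2norm_ge0 //.
by rewrite !l2norm_sqr dotp_mulmx mulmxA hU mul1mx.
Qed.

(** * The spectral norm *)

Lemma l2norm_mulmx_crude p q (M : 'M[R]_(p, q)) v :
  l2norm (M *m v) <= (\sum_(i < p) \sum_(j < q) `|M i j|) * l2norm v.
Proof.
apply: (le_trans (l2norm_le_sum _)); rewrite mulr_suml; apply: ler_sum => i _.
rewrite mxE mulr_suml; apply: (le_trans (ler_norm_sum _ _ _)).
by apply: ler_sum => j _; rewrite normrM ler_wpM2l // abs_le_l2norm.
Qed.

Lemma spectral_norm_has_sup p q (M : 'M[R]_(p, q)) :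
  has_sup [set l2norm (M *m v) | v in [set v : 'cV[R]_q | l2norm v <= 1]].
Proof.
split; first by exists (l2norm (M *m 0)), 0 => //=; rewrite l2norm0.
exists (\sum_(i < p) \sum_(j < q) `|M i j|) => _ [v /= v1 <-].
apply: (le_trans (l2norm_mulmx_crude _ _)).
by rewrite ler_piMr // sumr_ge0 // => i _; rewrite sumr_ge0.
Qed.

Lemma spectral_norm_ge0 p q (M : 'M[R]_(p, q)) : 0 <= spectral_norm M.
Proof.
apply: le_trans (l2norm_ge0 (M *m 0)) _.
by apply: (sup_upper_bound (spectral_norm_has_sup M)); exists 0 => //=; rewrite l2norm0.
Qed.

Lemma l2norm_mulmx p q (M : 'M[R]_(p, q)) v :
  l2norm (M *m v) <= spectral_norm M * l2norm v.
Proof.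
have [v0|v0] := eqVneq (l2norm v) 0.
  by have := l2norm_mulmx_crude M v; rewrite v0 !mulr0.
have vp : 0 < l2norm v by rewrite lt_neqAle eq_sym v0 l2norm_ge0.
have : l2norm (M *m ((l2norm v)^-1 *: v)) <= spectral_norm M.
  apply: (sup_upper_bound (spectral_norm_has_sup M)).
  exists ((l2norm v)^-1 *: v) => //=.
  by rewrite l2normZ gtr0_norm ?invr_gt0 // mulVf.
by rewrite -scalemxAr l2normZ gtr0_norm ?invr_gt0 // mulrC ler_pdivrMr.
Qed.

Lemma spectral_norm_le p q (M : 'M[R]_(p, q)) c :
  0 <= c -> (forall v, l2norm (M *m v) <= c * l2norm v) -> spectral_norm M <= c.
Proof.
move=> c0 h; apply: ge_sup; first by have [] := spectral_norm_has_sup M.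
move=> _ [v /= v1 <-]; apply: le_trans (h v) _.
by rewrite ler_piMr.
Qed.

Lemma spectral_normD p q (M M' : 'M[R]_(p, q)) :
  spectral_norm (M + M') <= spectral_norm M + spectral_norm M'.
Proof.
apply: spectral_norm_le; first by rewrite addr_ge0 ?spectral_norm_ge0.
move=> v; rewrite mulmxDl (le_trans (l2normD _ _)) // mulrDl.
by rewrite lerD ?l2norm_mulmx.
Qed.

Lemma spectral_normZ p q a (M : 'M[R]_(p, q)) :
  spectral_norm (a *: M) <= `|a| * spectral_norm M.
Proof.
apply: spectral_norm_le; first by rewrite mulr_ge0 ?spectral_norm_ge0.
move=> v; rewrite -scalemxAl l2normZ -mulrA ler_wpM2l //.
exact: l2norm_mulmx.
Qed.

Lemma spectral_norm_le_sum p q (M : 'M[R]_(p, q)) :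
  spectral_norm M <= \sum_(i < p) \sum_(j < q) `|M i j|.
Proof.
apply: spectral_norm_le (l2norm_mulmx_crude M).
by rewrite sumr_ge0 // => i _; rewrite sumr_ge0.
Qed.

Lemma spectral_norm_orthogonal k (U : 'M[R]_k) :
  U^T *m U = 1%:M -> spectral_norm U <= 1.
Proof.
by move=> hU; apply: spectral_norm_le => // v; rewrite mul1r l2norm_orthogonal.
Qed.

(** Duality: the square of [|M^T w|] is the inner product of [w] with [M M^T w],
    so Cauchy-Schwarz and the bound for [M] give one factor [|M^T w|] back. *)
Lemma l2norm_trmx_mulmx p q (M : 'M[R]_(p, q)) w :
  l2norm (M^T *m w) <= spectral_norm M * l2norm w.
Proof.
have [w0|w0] := eqVneq (l2norm (M^T *m w)) 0.
  by rewrite w0 mulr_ge0 ?spectral_norm_ge0 ?l2norm_ge0.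
have wp : 0 < l2norm (M^T *m w) by rewrite lt_neqAle eq_sym w0 l2norm_ge0.
rewrite -(ler_pM2r wp) -expr2 l2norm_sqr -dotp_mulmx.
apply: (le_trans (cauchy_schwarz _ _)).
rewrite mulrAC ler_wpM2r ?l2norm_ge0 //.
exact: l2norm_mulmx.
Qed.

(** * Projection onto a Euclidean ball *)

Lemma l2norm_ball_proj k (B : R) (x : 'cV[R]_k) :
  0 <= B -> l2norm (ball_proj B x) <= B.
Proof.
move=> B0; rewrite /ball_proj; case: ifPn => //; rewrite -ltNge => h.
have xp := le_lt_trans B0 h.
by rewrite l2normZ ger0_norm ?divr_ge0 ?l2norm_ge0 // divfK ?gt_eqF.
Qed.

Lemma ball_proj_id k (B : R) (x : 'cV[R]_k) :
  l2norm x <= B -> ball_proj B x = x.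
Proof. by rewrite /ball_proj => ->. Qed.

(** The variational characterization of the projection: seen from the projected
    point, the ball lies in the half-space away from [x].  Adding it for two
    points gives nonexpansiveness. *)
Lemma ball_proj_obtuse k (B : R) (x z : 'cV[R]_k) : 0 <= B -> l2norm z <= B ->
  dotp (x - ball_proj B x) (z - ball_proj B x) <= 0.
Proof.
move=> B0 zB; rewrite /ball_proj; case: ifPn => [_|].
  by rewrite subrr -(scale0r 0) dotpZl mul0r.
rewrite -ltNge => h; have xp := le_lt_trans B0 h.
rewrite -{1}(scale1r x) -scalerBl dotpZl pmulr_rle0; last first.
  by rewrite subr_gt0 ltr_pdivrMr // mul1r.
rewrite dotpBr dotpZr -l2norm_sqr expr2 mulrA divfK ?gt_eqF // subr_le0.
apply: (le_trans (cauchy_schwarz _ _)).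
by rewrite mulrC ler_wpM2r ?l2norm_ge0.
Qed.

Lemma ball_proj_nonexpansive k (B : R) (x y : 'cV[R]_k) : 0 <= B ->
  l2norm (ball_proj B x - ball_proj B y) <= l2norm (x - y).
Proof.
move=> B0; set p := ball_proj B x; set q := ball_proj B y.
have hp := ball_proj_obtuse x B0 (l2norm_ball_proj y B0).
have hq := ball_proj_obtuse y B0 (l2norm_ball_proj x B0).
rewrite -/p -/q in hp hq.
have [w0|w0] := eqVneq (l2norm (p - q)) 0; first by rewrite w0 l2norm_ge0.
have wp : 0 < l2norm (p - q) by rewrite lt_neqAle eq_sym w0 l2norm_ge0.
rewrite -(ler_pM2r wp) -expr2 l2norm_sqr.
apply: le_trans (cauchy_schwarz _ _).
move: hp hq; rewrite !(dotpBl, dotpBr) (dotpC q p); lra.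
Qed.

End Euclid.

(** * Stability of the network *)

Section Network.
Variable R : realType.

Lemma soft_nonexpansive (mu x y : R) : 0 <= mu ->
  `|soft mu x - soft mu y| <= `|x - y|.
Proof.
move=> mu0.
have E z : soft mu z = if mu < z then z - mu else if z < - mu then z + mu else 0.
  rewrite /soft; case: (ltgtP z 0) => hz.
  - rewrite ltr0_sg // ltr0_norm //; have -> : (mu < z) = false by lra.
    by rewrite maxEle; case: (leP 0 (_ - mu)) => ?; case: ltP => ? /=; lra.
  - rewrite gtr0_sg // gtr0_norm //; have -> : (z < - mu) = false by lra.
    by rewrite maxEle; case: (leP 0 (_ - mu)) => ?; case: ltP => ? /=; lra.
  - by rewrite hz sgr0 mul0r; case: ltP => ? /=; last (case: ltP => ? /=); lra.
by rewrite !E; case: (ltP mu x); case: (ltP mu y); case: (ltP x (- mu));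
  case: (ltP y (- mu)) => *; rewrite ler_norml; case: (ger0P (x - y)) => * /=; lra.
Qed.

Lemma soft0 (mu : R) : soft mu 0 = 0.
Proof. by rewrite /soft sgr0 mul0r. Qed.

Lemma softv_nonexpansive k (mu : R) (u v : 'cV[R]_k) : 0 <= mu ->
  l2norm (softv mu u - softv mu v) <= l2norm (u - v).
Proof. by move=> mu0; apply: ler_l2norm => i; rewrite !mxE soft_nonexpansive. Qed.

Lemma l2norm_softv k (mu : R) (u : 'cV[R]_k) : 0 <= mu ->
  l2norm (softv mu u) <= l2norm u.
Proof.
move=> mu0; have := softv_nonexpansive u 0 mu0.
suff -> : softv mu (0 : 'cV[R]_k) = 0 by rewrite !subr0.
by apply/matrixP => i j; rewrite !mxE soft0.
Qed.

Variables (n N : nat) (A : 'M[R]_(n, N)) (tau lambda : R).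
Hypotheses (tau_ge0 : 0 <= tau) (lambda_ge0 : 0 <= lambda).
Hypothesis tauA : tau * spectral_norm A ^+ 2 <= 1.
Implicit Types (Phi Psi : 'M[R]_N) (x v g : 'cV[R]_N).

Let mu_ge0 : 0 <= tau * lambda. Proof. exact: mulr_ge0. Qed.

Definition gradient_step x g : 'cV[R]_N := g + tau *: (A^T *m A *m (x - g)).

Definition thresholding_step Phi v : 'cV[R]_N :=
  Phi *m softv (tau * lambda) (Phi^T *m v).

Definition synthesis Phi l x : 'cV[R]_N :=
  Phi *m thresholding_net A tau lambda Phi l (A *m x).

(** In the signal domain one layer is a gradient step that does not involve
    [Phi], followed by thresholding of the coefficients with respect to the
    basis [Phi]; only the second half has to be perturbed when [Phi] changes.
    Since the value at [l = 0] is zero, the first layer has the same form. *)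
Lemma synthesisS Phi l x : Phi^T *m Phi = 1%:M ->
  synthesis Phi l.+1 x
    = thresholding_step Phi (gradient_step x (synthesis Phi l x)).
Proof.
move=> hPhi; rewrite /synthesis /thresholding_step.
have E f : (1%:M - tau *: (Phi^T *m A^T *m A *m Phi)) *m f
     + tau *: ((A *m Phi)^T *m (A *m x))
   = Phi^T *m gradient_step x (Phi *m f).
  rewrite /gradient_step mulmxDr [Phi^T *m (Phi *m f)]mulmxA hPhi mul1mx mulmxBl mul1mx.
  rewrite -addrA.
  congr (_ + _); rewrite -scalemxAr -scalemxAl -scalerN -scalerDr; congr (_ *: _).
  by rewrite !mulmxBr trmx_mul !mulmxA addrC.
by rewrite -E; case: l => [|l] //=; rewrite mulmx0 add0r.
Qed.

(** This and the next lemma express that [0 <= tau A^T A <= 1] in the order of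
    symmetric matrices, which is the meaning of the step size condition. *)
Lemma scaled_gram_nonexpansive v : l2norm (tau *: (A^T *m A *m v)) <= l2norm v.
Proof.
rewrite l2normZ ger0_norm // -mulmxA.
apply: le_trans (ler_wpM2l tau_ge0 (l2norm_trmx_mulmx _ _)) _.
apply: le_trans (ler_wpM2l tau_ge0
  (ler_wpM2l (spectral_norm_ge0 _) (l2norm_mulmx _ _))) _.
by rewrite !mulrA -[X in X * _]mulrA -expr2 ler_piMl ?l2norm_ge0.
Qed.

Lemma residual_nonexpansive v : l2norm (v - tau *: (A^T *m A *m v)) <= l2norm v.
Proof.
rewrite -(ler_pXn2r (n := 2)) ?nnegrE ?l2norm_ge0 //.
rewrite [in leLHS]l2norm_sqr dotpBl !dotpBr !dotpZl !dotpZr -!l2norm_sqr.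
rewrite (dotpC v) -!mulmxA dotp_mulmx trmxK -l2norm_sqr.
set a := l2norm (A *m v); set b := l2norm (A^T *m _).
have ba : tau * b ^+ 2 <= a ^+ 2.
  apply: (@le_trans _ _ (tau * (spectral_norm A * a) ^+ 2)).
    rewrite ler_wpM2l // lerXn2r ?nnegrE ?mulr_ge0 ?l2norm_ge0 ?spectral_norm_ge0 //.
    exact: l2norm_trmx_mulmx.
  by rewrite exprMn mulrA ler_piMl // exprn_ge0 // l2norm_ge0.
have := ler_wpM2l tau_ge0 ba; have := mulr_ge0 tau_ge0 (sqr_ge0 a); lra.
Qed.

Lemma l2norm_gradient_step x g : l2norm (gradient_step x g) <= l2norm g + l2norm x.
Proof.
have -> : gradient_step x g
    = (g - tau *: (A^T *m A *m g)) + tau *: (A^T *m A *m x).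
  by rewrite /gradient_step mulmxBr scalerBr addrAC addrA.
apply: (le_trans (l2normD _ _)).
exact: lerD (residual_nonexpansive _) (scaled_gram_nonexpansive _).
Qed.

Lemma gradient_step_dist x x' g g' :
  l2norm (gradient_step x g - gradient_step x' g')
    <= l2norm (g - g') + l2norm (x - x').
Proof.
suff -> : gradient_step x g - gradient_step x' g' = gradient_step (x - x') (g - g').
  exact: l2norm_gradient_step.
rewrite /gradient_step opprD addrACA; congr (_ + _).
by rewrite -scalerBr -mulmxBr; congr (_ *: (_ *m _)); rewrite !opprD !opprK addrACA.
Qed.

Lemma thresholding_step_nonexpansive Phi v v' : Phi^T *m Phi = 1%:M ->
  l2norm (thresholding_step Phi v - thresholding_step Phi v') <= l2norm (v - v').
Proof.
move=> hPhi; rewrite -mulmxBr l2norm_orthogonal //.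
apply: (le_trans (softv_nonexpansive _ _ mu_ge0)).
by rewrite -mulmxBr l2norm_orthogonal // trmxK (mulmx1C hPhi).
Qed.

Lemma l2norm_thresholding_step Phi v : Phi^T *m Phi = 1%:M ->
  l2norm (thresholding_step Phi v) <= l2norm v.
Proof.
move=> hPhi; rewrite l2norm_orthogonal //.
apply: (le_trans (l2norm_softv _ mu_ge0)).
by rewrite l2norm_orthogonal // trmxK (mulmx1C hPhi).
Qed.

Lemma thresholding_step_lipschitz Phi Psi v :
  Phi^T *m Phi = 1%:M -> Psi^T *m Psi = 1%:M ->
  l2norm (thresholding_step Phi v - thresholding_step Psi v)
    <= 2 * spectral_norm (Phi - Psi) * l2norm v.
Proof.
move=> hPhi hPsi; rewrite /thresholding_step.
set a := softv _ _; set b := softv _ _.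
have -> : Phi *m a - Psi *m b = (Phi - Psi) *m a + Psi *m (a - b).
  by rewrite mulmxBl mulmxBr addrA subrK.
apply: (le_trans (l2normD _ _)); rewrite -mulrA (mulr_natl _ 2) mulr2n.
apply: lerD.
  apply: (le_trans (l2norm_mulmx _ _)); rewrite ler_wpM2l ?spectral_norm_ge0 //.
  apply: (le_trans (l2norm_softv _ mu_ge0)).
  by rewrite l2norm_orthogonal // trmxK (mulmx1C hPhi).
rewrite l2norm_orthogonal //; apply: (le_trans (softv_nonexpansive _ _ mu_ge0)).
by rewrite -mulmxBl -linearB /= l2norm_trmx_mulmx.
Qed.

(** Each gradient step adds at most [|x|] to the norm, so the outputs grow at
    most linearly with the depth. *)
Lemma l2norm_synthesis Phi l x : Phi^T *m Phi = 1%:M ->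
  l2norm (synthesis Phi l x) <= l%:R * l2norm x.
Proof.
move=> hPhi; elim: l => [|l IH]; first by rewrite /synthesis /= mulmx0 l2norm0 mul0r.
rewrite synthesisS // (le_trans (l2norm_thresholding_step _ hPhi)) //.
apply: (le_trans (l2norm_gradient_step _ _)).
by rewrite -natr1 mulrDl mul1r lerD2r.
Qed.

Lemma synthesis_lipschitz_signal Phi l x x' : Phi^T *m Phi = 1%:M ->
  l2norm (synthesis Phi l x - synthesis Phi l x') <= l%:R * l2norm (x - x').
Proof.
move=> hPhi; elim: l => [|l IH].
  by rewrite /synthesis /= mulmx0 subrr l2norm0 mul0r.
rewrite !synthesisS // (le_trans (thresholding_step_nonexpansive _ _ hPhi)) //.
apply: (le_trans (gradient_step_dist _ _ _ _)).
by rewrite -natr1 mulrDl mul1r lerD2r.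
Qed.

(** Exchanging the basis in layer [l + 1] moves its output by at most
    [2 (l + 1) |x|] times the distance of the bases: once for the synthesis and
    once for the analysis operator, at a point of norm at most [(l + 1) |x|].
    All later layers are nonexpansive, so these costs just add up, and
    [2 + 4 + ... + 2 l = l (l + 1)]. *)
Lemma synthesis_lipschitz_basis Phi Psi l x :
  Phi^T *m Phi = 1%:M -> Psi^T *m Psi = 1%:M ->
  l2norm (synthesis Phi l x - synthesis Psi l x)
    <= (l * l.+1)%:R * spectral_norm (Phi - Psi) * l2norm x.
Proof.
move=> hPhi hPsi; elim: l => [|l IH].
  by rewrite /synthesis /= !mulmx0 subrr l2norm0 !mul0r.
rewrite !synthesisS //.
set u := gradient_step x _; set v := gradient_step x _.
rewrite -(subrK (thresholding_step Phi v) (thresholding_step Phi u)) -addrA.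
apply: (le_trans (l2normD _ _)).
have h1 : l2norm (thresholding_step Phi u - thresholding_step Phi v)
    <= (l * l.+1)%:R * spectral_norm (Phi - Psi) * l2norm x.
  apply: (le_trans (thresholding_step_nonexpansive _ _ hPhi)).
  by apply: (le_trans (gradient_step_dist _ _ _ _)); rewrite subrr l2norm0 addr0.
have h2 : l2norm v <= l.+1%:R * l2norm x.
  apply: (le_trans (l2norm_gradient_step _ _)).
  by rewrite -natr1 mulrDl mul1r lerD2r l2norm_synthesis.
have h3 := thresholding_step_lipschitz v hPhi hPsi.
have s0 : 0 <= 2 * spectral_norm (Phi - Psi) by rewrite mulr_ge0 ?spectral_norm_ge0.
apply: le_trans (lerD h1 (le_trans h3 (ler_wpM2l s0 h2))) _.
rewrite !natrM -!natr1; lra.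
Qed.

Variables (B : R) (L : nat).
Hypothesis B_ge0 : 0 <= B.

Definition network Phi (y : 'cV[R]_n) : 'cV[R]_N :=
  ball_proj B (Phi *m thresholding_net A tau lambda Phi L y).

Definition net_loss Phi x : R := loss (network Phi) x (A *m x).

Lemma net_lossE Phi x :
  net_loss Phi x = l2norm (ball_proj B (synthesis Phi L x) - x).
Proof. by []. Qed.

Lemma net_loss_ge0 Phi x : 0 <= net_loss Phi x.
Proof. exact: l2norm_ge0. Qed.

Lemma net_loss_le Phi x : l2norm x <= B -> net_loss Phi x <= 2 * B.
Proof.
move=> xB; rewrite net_lossE (le_trans (l2normB _ _)) // mulr_natl mulr2n.
by rewrite lerD ?l2norm_ball_proj.
Qed.

Lemma net_loss_lipschitz_basis Phi Psi x :
  Phi^T *m Phi = 1%:M -> Psi^T *m Psi = 1%:M ->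
  `|net_loss Phi x - net_loss Psi x|
    <= (L * L.+1)%:R * spectral_norm (Phi - Psi) * l2norm x.
Proof.
move=> hPhi hPsi; rewrite !net_lossE (le_trans (l2norm_dist_dist _ _)) //.
rewrite opprB addrA subrK (le_trans (ball_proj_nonexpansive _ _ B_ge0)) //.
exact: synthesis_lipschitz_basis.
Qed.

Lemma net_loss_lipschitz_signal Phi x x' : Phi^T *m Phi = 1%:M ->
  `|net_loss Phi x - net_loss Phi x'| <= L.+1%:R * l2norm (x - x').
Proof.
move=> hPhi; rewrite !net_lossE (le_trans (l2norm_dist_dist _ _)) //.
have -> (a b : 'cV[R]_N) : a - x - (b - x') = (a - b) + (x' - x).
  by rewrite opprB addrACA [RHS]addrACA [- b - x]addrC.
rewrite (le_trans (l2normD _ _)) // -natr1 mulrDl mul1r (l2norm_distC x').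
rewrite lerD2r (le_trans (ball_proj_nonexpansive _ _ B_ge0)) //.
by rewrite synthesis_lipschitz_signal.
Qed.

End Network.

(** * Covering numbers in spectral norm *)

Section Covering.
Variable R : realType.

Lemma le1_of_bounded_powers (a C : R) :
  0 <= a -> (forall k, a ^+ k <= C) -> a <= 1.
Proof.
move=> a0 h; rewrite leNgt; apply/negP => a1.
have bernoulli k : 1 + k%:R * (a - 1) <= a ^+ k.
  elim: k => [|k IH]; first by rewrite mul0r addr0.
  rewrite exprS; apply: le_trans (ler_wpM2l a0 IH).
  have := mulr_ge0 (ler0n R k) (sqr_ge0 (a - 1)); rewrite -natr1; lra.
have d0 : 0 < a - 1 by lra.
pose k := (Num.truncn (C / (a - 1))).+1.
have : C / (a - 1) < k%:R by exact: truncnS_gt.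
rewrite ltr_pdivrMr //; have := bernoulli k; have := h k; lra.
Qed.

Variables p q : nat.
Implicit Types M : 'M[R]_(p, q).

Lemma spectral_normN M : spectral_norm (- M) = spectral_norm M.
Proof.
have h M' : spectral_norm (- M') <= spectral_norm M'.
  by rewrite -scaleN1r (le_trans (spectral_normZ _ _)) // normrN1 mul1r.
by apply/eqP; rewrite eq_le h -{1}(opprK M) h.
Qed.

Lemma spectral_norm_distC M M' : spectral_norm (M - M') = spectral_norm (M' - M).
Proof. by rewrite -opprB spectral_normN. Qed.

Lemma abs_le_spectral_norm M i j : `|M i j| <= spectral_norm M.
Proof.
have d1 : l2norm (delta_mx j 0 : 'cV[R]_q) = 1.
  rewrite /l2norm (bigD1 j) //= big1 ?addr0 ?mxE ?eqxx ?expr1n ?sqrtr1 //.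
  by move=> k kj; rewrite mxE (negbTE kj) expr0n.
have := l2norm_mulmx M (delta_mx j 0); rewrite d1 mulr1.
apply: le_trans; apply: le_trans (abs_le_l2norm _ i).
by rewrite -colE mxE.
Qed.

Section Packing.
Variables (eps : R) (K : nat) (c : 'I_K -> 'M[R]_(p, q)).
Hypothesis eps_gt0 : 0 < eps.
Hypothesis c_ball : forall i, spectral_norm (c i) <= 1.
Hypothesis c_sep : forall i j, i != j -> eps <= spectral_norm (c i - c j).

(* With this ratio, a difference in one digit of an expansion exceeds what all
   later digits can compensate, with [eps / 3] to spare. *)
Let theta := eps / (3 + eps).

Let theta_gt0 : 0 < theta.
Proof. by rewrite divr_gt0 // addr_gt0. Qed.

Let theta_le1 : theta <= 1.
Proof. by rewrite /theta ler_pdivrMr ?addr_gt0 // mul1r lerDr. Qed.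

(* The sum of the geometric series of ratio [theta]. *)
Let radius := 1 + eps / 3.

Let radiusE : 1 + theta * radius = radius.
Proof. by rewrite /theta /radius; field; rewrite gt_eqF ?addr_gt0. Qed.

(** The matrices with digits [s] in base [1 / theta], with the packing as the set
    of digits: self-similar copies of the packing inside a ball of fixed radius. *)
Fixpoint expansion (s : seq 'I_K) : 'M[R]_(p, q) :=
  if s is a :: s' then c a + theta *: expansion s' else 0.

Lemma expansion_ball s : spectral_norm (expansion s) <= radius.
Proof.
elim: s => [|a s IH] /=.
  apply: le_trans (spectral_norm_le_sum _) _; rewrite big1 ?addr_ge0 //; last first.
    by move=> i _; rewrite big1 // => j _; rewrite mxE normr0.
  by rewrite divr_ge0 // ltW.
apply: (le_trans (spectral_normD _ _)); rewrite -radiusE lerD //.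
apply: (le_trans (spectral_normZ _ _)).
by rewrite gtr0_norm // ler_wpM2l // ltW.
Qed.

Lemma expansion_separated s t : size s = size t -> s != t ->
  theta ^+ size s * (eps / 3) <= spectral_norm (expansion s - expansion t).
Proof.
have eps3 : 0 <= eps / 3 by rewrite divr_ge0 // ltW.
elim: s t => [|a s IH] [|b t] //= [st] neq.
rewrite opprD addrACA -scalerBr.
have [eab|nab] := eqVneq a b.
  have nst : s != t by apply: contra neq => /eqP ->; rewrite eab.
  rewrite eab subrr add0r exprS -mulrA -ler_pdivlMl //.
  apply: (le_trans (IH _ st nst)).
  rewrite -{1}(scale1r (expansion s - expansion t)) -(mulVf (lt0r_neq0 theta_gt0)).
  rewrite -scalerA; apply: (le_trans (spectral_normZ _ _)).
  by rewrite gtr0_norm // invr_gt0.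
set u := c a - c b; set v := theta *: _.
have hv : spectral_norm v <= theta * (radius + radius).
  apply: (le_trans (spectral_normZ _ _)); rewrite gtr0_norm // (ler_wpM2l (ltW theta_gt0)) //.
  apply: (le_trans (spectral_normD _ _)).
  by rewrite spectral_normN lerD // expansion_ball.
have hu : spectral_norm u <= spectral_norm (u + v) + spectral_norm v.
  by rewrite -(spectral_normN v) -{1}(addrK v u) spectral_normD.
have hc := c_sep nab; rewrite -/u in hc.
have h1 : theta ^+ (size s).+1 * (eps / 3) <= eps / 3.
  by rewrite ler_piMl // exprn_ile1 // ltW.
move: radiusE; rewrite /radius => hr; apply: (le_trans h1).
move: hv; rewrite /radius; lra.
Qed.

(** The classical volume bound, obtained without volumes: the [K ^ k] expansions
    of length [k] are separated at scale [theta ^ k], so a crude pigeonhole on a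
    cubic grid gives [K ^ k <= C * theta ^ (- k p q)] with [C] independent of
    [k], and however large [C] is, it disappears from the exponential rate.  The
    dimension enters only through the exponent [p q]; a grid alone would put a
    power of the dimension into the base. *)
Lemma packing_card : K%:R <= (1 + 3 / eps) ^+ (p * q).
Proof.
have r0 : 0 < radius by rewrite addr_gt0 // divr_gt0.
pose C := 6 * radius * (p * q).+1%:R / eps + 1.
have C0 : 0 <= C by rewrite addr_ge0 // divr_ge0 ?mulr_ge0 // ltW.
suff h k : (K%:R * theta ^+ (p * q)) ^+ k <= C ^+ (p * q).
  have Kt0 : 0 <= K%:R * theta ^+ (p * q) by rewrite mulr_ge0 // exprn_ge0 // ltW.
  have := le1_of_bounded_powers Kt0 h.
  have -> : 1 + 3 / eps = theta^-1.
    by rewrite /theta invf_div; field; rewrite gt_eqF.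
  by rewrite exprVn -[_^-1]mul1r ler_pdivlMr // exprn_gt0.
have tk0 : 0 < theta ^+ k by exact: exprn_gt0.
pose w := theta ^+ k * (eps / 3) / (p * q).+1%:R.
have w0 : 0 < w by rewrite divr_gt0 // mulr_gt0 // divr_gt0.
pose G := (Num.truncn (2 * radius / w)).+1.
have hb (t : k.-tuple 'I_K) i j : `|expansion t i j| <= radius.
  exact: le_trans (abs_le_spectral_norm _ _ _) (expansion_ball _).
pose coord (t : k.-tuple 'I_K) i j := (expansion t i j + radius) / w.
have coord0 t i j : 0 <= coord t i j.
  by rewrite divr_ge0 ?(ltW w0) //; have := hb t i j; rewrite ler_norml; lra.
have coordG t i j : (Num.truncn (coord t i j) < G)%N.
  rewrite ltnS le_truncn // ler_pM2r ?invr_gt0 //.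
  by have := hb t i j; rewrite ler_norml; lra.
pose cell (t : k.-tuple 'I_K) : {ffun 'I_p * 'I_q -> 'I_G} :=
  [ffun ij => Ordinal (coordG t ij.1 ij.2)].
have cell_inj : injective cell.
  move=> s t est; apply/eqP; apply/negPn/negP => nst.
  (* Points in the same cell have nearby entries, hence small spectral distance. *)
  have near i j : `|(expansion s - expansion t) i j| <= w.
    have : Num.truncn (coord s i j) = Num.truncn (coord t i j).
      by move/ffunP: est => /(_ (i, j)); rewrite !ffunE => /(congr1 val).
    have /andP[] := truncn_itv (coord0 s i j).
    have /andP[] := truncn_itv (coord0 t i j).
    move=> a1 a2 b1 b2 e; rewrite e in b1 b2.
    have : `|coord s i j - coord t i j| <= 1.
      by move: a2 b2; rewrite -natr1 ler_norml; lra.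
    rewrite /coord -mulrBl normrM [`|w^-1|]gtr0_norm ?invr_gt0 //.
    by rewrite ler_pdivrMr // mul1r !mxE opprD addrACA subrr addr0.
  have := expansion_separated (s := s) (t := t); rewrite !size_tuple.
  move=> /(_ erefl nst); apply/negP; rewrite -ltNge.
  apply: (le_lt_trans (spectral_norm_le_sum _)).
  apply: (@le_lt_trans _ _ ((p * q)%:R * w)).
    apply: (@le_trans _ _ (\sum_(i < p) \sum_(j < q) w)).
      by apply: ler_sum => i _; apply: ler_sum => j _.
    by rewrite !sumr_const !card_ord -mulrnA mulr_natl mulnC.
  rewrite /w mulrCA gtr_pMr ?mulr_gt0 ?divr_gt0 //.
  by rewrite ltr_pdivrMr // mul1r ltr_nat.
have := leq_card _ cell_inj.
rewrite card_tuple card_ffun !card_ord card_prod !card_ord.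
rewrite -(ler_nat R) !natrX => hK.
have hG : G%:R * theta ^+ k <= C.
  have : G%:R <= 2 * radius / w + 1.
    rewrite /G -[leLHS]natr1 lerD2r truncn_le.
    by rewrite divr_ge0 ?mulr_ge0 // ltW.
  move=> /(ler_wpM2r (ltW tk0)) hG; apply: (le_trans hG).
  rewrite mulrDl mul1r; apply: lerD; last by rewrite exprn_ile1 // ltW.
  rewrite le_eqVlt; apply/orP; left; apply/eqP; rewrite /w.
  by field; rewrite !lt0r_neq0.
rewrite exprMn -exprM mulnC exprM.
apply: le_trans (ler_wpM2r _ hK) _; first by rewrite exprn_ge0 // exprn_ge0 // ltW.
rewrite -exprMn lerXn2r ?nnegrE ?mulr_ge0 // ltW //.
Qed.

End Packing.

(** A maximal separated family is a net; [packing_card] makes it exist. *)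
Lemma finite_net (S : set 'M[R]_(p, q)) (eps : R) : 0 < eps ->
  (forall M, S M -> spectral_norm M <= 1) ->
  exists s : seq 'M[R]_(p, q),
    [/\ forall M, M \in s -> S M,
        forall M, S M -> exists2 M', M' \in s & spectral_norm (M - M') <= eps
      & (size s)%:R <= (1 + 3 / eps) ^+ (p * q)].
Proof.
move=> eps0 S1.
pose sep (M M' : 'M[R]_(p, q)) := eps <= spectral_norm (M - M').
pose packing s := (forall M, M \in s -> S M) /\ pairwise sep s.
have card_packing s : packing s -> (size s)%:R <= (1 + 3 / eps) ^+ (p * q).
  move=> [sS /(pairwiseP 0) ss].
  apply: (@packing_card _ _ (fun i : 'I_(size s) => nth 0 s i)) => //.
    by move=> i; apply: S1; apply: sS; rewrite mem_nth.
  move=> i j; rewrite neq_ltn => /orP[ij|ji].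
    by apply: ss; rewrite ?inE.
  by rewrite spectral_norm_distC; apply: ss; rewrite ?inE.
pose P k := `[< exists s, packing s /\ size s = k >].
have P0 : exists k, P k.
  by exists 0%N; apply/asboolP; exists [::]; split => //; split.
have Pb k : P k -> (k <= Num.truncn ((1 + 3 / eps) ^+ (p * q) : R))%N.
  move=> /asboolP[s [/card_packing h <-]].
  by rewrite truncn_ge_nat // exprn_ge0 // addr_ge0 // divr_ge0 // ltW.
case: (ex_maxnP P0 Pb) => k /asboolP[s [ps sk]] kmax.
exists s; split; [by case: ps | | exact: card_packing].
move=> M SM; apply: contrapT => far.
suff : P k.+1 by move=> /kmax; rewrite ltnn.
apply/asboolP; exists (M :: s); split; last by rewrite /= sk.
case: ps => sS ss; split.
  by move=> M'; rewrite inE => /orP[/eqP ->//|]; exact: sS.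
rewrite /= ss andbT; apply/allP => M' M's; rewrite /sep leNgt; apply/negP => lt.
by apply: far; exists M' => //; exact: ltW.
Qed.

End Covering.

(** * A deviation inequality for independent samples *)

Section ScalarInequality.
Variable R : realType.

Lemma expR_ge_sqr (y : R) : 0 <= y -> 1 + y + y ^+ 2 / 4 <= expR y.
Proof.
move=> y0; have -> : 1 + y + y ^+ 2 / 4 = (1 + y / 2) ^+ 2 by field.
have -> : expR y = expR (y / 2) ^+ 2.
  by rewrite expr2 -expRD; congr expR; field.
by rewrite lerXn2r ?nnegrE ?expR_ge0 ?expR_ge1Dx // addr_ge0 // divr_ge0.
Qed.

(** This pointwise bound has no term of first order besides [x] itself, so for
    a centred variable it controls the moment generating function without any
    convexity argument.  On [[0, 1]] it reduces to a polynomial inequality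
    through [exp (- x) >= (1 - x / 4) ^ 4]. *)
Lemma expR_le_add_expR_sqr (x : R) : expR x <= x + expR (x ^+ 2).
Proof.
have [x0|x0] := ltP x 0.
  have d0 : 0 < 1 - x by lra.
  apply: (@le_trans _ _ ((1 - x)^-1)).
    by rewrite -[x in expR x]opprK expRN lef_pV2 ?posrE ?expR_gt0 // expR_ge1Dx.
  apply: (@le_trans _ _ (1 + x + x ^+ 2)); last first.
    by have := expR_ge1Dx (x ^+ 2); lra.
  rewrite -[_^-1]mul1r ler_pdivrMr //.
  have := mulr_ge0 (sqr_ge0 x) (_ : 0 <= - x); lra.
have [x1|x1] := leP 1 x.
  apply: (@le_trans _ _ (expR (x ^+ 2))); last by lra.
  by rewrite ler_expR expr2 ler_peMr.
apply: (@le_trans _ _ (1 + x + x ^+ 2 + x ^+ 4 / 4)); last first.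
  have := expR_ge_sqr (sqr_ge0 x); rewrite -exprM; lra.
have q0 : 0 < 1 - x / 4 by lra.
apply: (@le_trans _ _ (((1 - x / 4) ^+ 4)^-1)).
  rewrite -[x in expR x]opprK expRN lef_pV2 ?posrE ?expR_gt0 ?exprn_gt0 //.
  have -> : expR (- x) = expR (- (x / 4)) ^+ 4.
    by rewrite -expRM_natl; congr expR; field.
  by rewrite lerXn2r ?nnegrE ?expR_ge0 ?(ltW q0) // expR_ge1Dx.
rewrite -[_^-1]mul1r ler_pdivrMr ?exprn_gt0 // -subr_ge0.
have -> : (1 + x + x ^+ 2 + x ^+ 4 / 4) * (1 - x / 4) ^+ 4 - 1 =
    x ^+ 2 / 16 * (7 / 16 + 39 / 16 * (1 - x) + 29 / 16 * (1 - x) ^+ 2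
      + 5 / 16 * ((1 - x) ^+ 2 * x) + 21 / 16 * (1 - x) ^+ 4
      + 4 / 16 * (x ^+ 4 * (1 - x)) + x ^+ 6 / 64).
  by field.
have y0 : 0 <= 1 - x by lra.
by rewrite mulr_ge0 ?divr_ge0 ?sqr_ge0 // !addr_ge0 ?mulr_ge0 ?divr_ge0 ?exprn_ge0.
Qed.

End ScalarInequality.

Section BoundedIntegral.
Context {R : realType} {d : measure_display} {E : measurableType d}.
Variable D : probability E R.

Definition bounded_measurable (f : E -> R) :=
  measurable_fun [set: E] f /\ exists M, forall x, `|f x| <= M.

Lemma bounded_measurable_integrable f :
  bounded_measurable f -> D.-integrable [set: E] (EFin \o f).
Proof.
move=> [mf [M fM]]; apply: measurable_bounded_integrable => //.
  exact: le_lt_trans (probability_le1 D measurableT) (ltry 1).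
exists M; split; first exact: num_real.
by move=> r Mr x _; apply: le_trans (fM x) (ltW Mr).
Qed.

Lemma bounded_measurable_cst (a : R) : bounded_measurable (cst a).
Proof. by split; [exact: measurable_cst | exists `|a|]. Qed.

Lemma Rintegral_probability_cst (a : R) : \int[D]_x a = a.
Proof.
have := Rintegral_cst D measurableT a.
by rewrite [fine _](_ : _ = 1) ?mulr1 //= probability_setT.
Qed.

Lemma EFin_Rintegral f : bounded_measurable f ->
  (\int[D]_x (f x)%:E)%E = (\int[D]_x f x)%:E.
Proof.
move=> bf; rewrite /Rintegral fineK //.
exact: (integrable_fin_num _ (bounded_measurable_integrable bf)).
Qed.

Lemma Rintegral_simple (q : nat) (idx : E -> 'I_q) (a : 'I_q -> R) :
  (forall j, measurable (idx @^-1` [set j])) -> (forall j, 0 <= a j) ->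
  (\int[D]_x (a (idx x))%:E)%E = (\sum_(j < q) a j * fine (D (idx @^-1` [set j])))%:E.
Proof.
move=> midx a0.
transitivity (\int[D]_x \sum_(j < q) (a j)%:E * (\1_(idx @^-1` [set j]) x)%:E)%E.
  apply: eq_integral => x _; rewrite (bigD1 (idx x)) //= big1 ?adde0.
    by rewrite indicE mem_set // mule1.
  move=> j ji; rewrite indicE memNset ?mule0 // => e.
  by move: ji; rewrite -e eqxx.
rewrite ge0_integral_sum //; last 2 first.
- by move=> j; apply/measurable_EFinP/measurable_funM => //; exact: measurable_indic.
- by move=> j x _; rewrite mule_ge0 // lee_fin.
rewrite -sumEFin; apply: eq_bigr => j _.
rewrite ge0_integralZl_EFin //; last first.
  by apply/measurable_EFinP; exact: measurable_indic.
by rewrite integral_indic // setIT EFinM fineK ?fin_num_measure.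
Qed.

End BoundedIntegral.

Section IndependentSample.
Context {R : realType} {d d' : measure_display}.
Context {T : measurableType d} {E : measurableType d'}.
Variables (P : probability T R) (D : probability E R).
Variables (m : nat) (X : 'I_m -> {RV P >-> E}).
Hypothesis hX : iid_sample D X.

(** For a function with finitely many values, expanding the product of sums over
    all patterns of values reduces the claim to the product rule for events. *)
Lemma expectation_prod_simple (q : nat) (idx : E -> 'I_q) (a : 'I_q -> R) :
  (forall j, measurable (idx @^-1` [set j])) -> (forall j, 0 <= a j) ->
  (\int[P]_w (\prod_(i < m) a (idx (X i w)))%:E)%E
    = ((\sum_(j < q) a j * fine (D (idx @^-1` [set j]))) ^+ m)%:E.
Proof.
move=> midx a0; case: hX => hD hind.
pose A j := idx @^-1` [set j].
pose C (phi : {ffun 'I_m -> 'I_q}) : set T :=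
  \bigcap_(i in [set` [set: 'I_m]%SET]) (X i @^-1` A (phi i)).
have mC phi : measurable (C phi).
  apply: fin_bigcap_measurable => // i _.
  by rewrite -[X in measurable X]setTI; apply: measurable_funP => //; exact: midx.
have PC phi : P (C phi) = (\prod_(i < m) fine (D (A (phi i))))%:E.
  rewrite hind; last by move=> i; exact: midx.
  rewrite -prodEFin; under eq_bigl do rewrite inE.
  apply: eq_bigr => i _; rewrite fineK ?fin_num_measure //; last exact: midx.
  by rewrite -(hD i) //; exact: midx.
transitivity (\int[P]_w \sum_(phi : {ffun 'I_m -> 'I_q}) (\prod_(i < m) a (phi i))%:E * (\1_(C phi) w)%:E)%E.
  apply: eq_integral => w _; pose phi0 := [ffun i => idx (X i w)].
  rewrite (bigD1 phi0) //= [X in _ + X]big1 ?addr0.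
    rewrite indicE; have -> : w \in C phi0 = true.
      by apply: mem_set => i _ /=; rewrite /A /= ffunE.
    by rewrite mule1; congr EFin; apply: eq_bigr => i _; rewrite ffunE.
  move=> phi nphi; rewrite indicE memNset ?mule0 // => Cw.
  move/eqP: nphi; apply; apply/ffunP => i; rewrite ffunE.
  by apply/esym; apply: Cw; rewrite /= inE.
have pa0 phi : 0 <= \prod_(i < m) a (phi i) by exact: prodr_ge0.
rewrite ge0_integral_sum //; last 2 first.
- by move=> j; apply/measurable_EFinP/measurable_funM => //; exact: measurable_indic.
- by move=> j x _; rewrite mule_ge0 // lee_fin.
have -> : (\sum_(j < q) a j * fine (D (A j))) ^+ m =
    \sum_(phi : {ffun 'I_m -> 'I_q}) \prod_(i < m) (a (phi i) * fine (D (A (phi i)))).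
  by rewrite -(bigA_distr_bigA (fun (_ : 'I_m) j => a j * fine (D (A j)))) prodr_const card_ord.
rewrite -sumEFin; apply: eq_bigr => phi _.
rewrite ge0_integralZl_EFin //; last first.
  by apply/measurable_EFinP; exact: measurable_indic.
by rewrite integral_indic // setIT [X in (_ * X)%E = _]PC -EFinM big_split.
Qed.

Lemma measurable_comp_sample (u : E -> R) i :
  measurable_fun [set: E] u -> measurable_fun [set: T] (fun w => u (X i w)).
Proof. by move=> mu; apply: (measurableT_comp mu); exact: measurable_funP. Qed.

(** Rounding [u] up to a multiple of a small [eta] produces finitely many values
    and raises the integral by at most [eta], which then tends to [0]. *)
Lemma expectation_prod_le (u : E -> R) : bounded_measurable u -> (forall x, 0 <= u x) ->
  (\int[P]_w (\prod_(i < m) u (X i w))%:E <= ((\int[D]_x u x) ^+ m)%:E)%E.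
Proof.
move=> bu u0; have [mu [M uM]] := bu; set I := \int[D]_x u x.
have I0 : 0 <= I by exact: Rintegral_ge0.
have approx eta : 0 < eta ->
    (\int[P]_w (\prod_(i < m) u (X i w))%:E <= ((I + eta) ^+ m)%:E)%E.
  move=> eta0.
  pose q := (Num.truncn (M / eta)).+1.
  have ltq x : (Num.truncn (u x / eta) < q)%N.
    rewrite ltnS le_truncn // ler_pM2r ?invr_gt0 //.
    exact: le_trans (ler_norm _) (uM x).
  pose idx x : 'I_q := Ordinal (ltq x).
  pose a (j : 'I_q) : R := j.+1%:R * eta.
  have a0 j : 0 <= a j by rewrite mulr_ge0 // ltW.
  have u_itv x : eta * (idx x)%:R <= u x < eta * (idx x).+1%:R.
    have /truncn_itv : 0 <= u x / eta by rewrite divr_ge0 // ltW.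
    by rewrite ler_pdivlMr // ltr_pdivrMr // !(mulrC eta).
  have midx j : measurable (idx @^-1` [set j]).
    have -> : idx @^-1` [set j] = u @^-1` `[eta * j%:R, eta * j.+1%:R[%classic.
      apply/seteqP; split=> x /=; first by move=> <-; rewrite in_itv /= u_itv.
      rewrite in_itv /= => /andP[h1 h2]; apply/val_inj/eqP => /=.
      rewrite truncn_eq; last by rewrite divr_ge0 // ltW.
      by rewrite ler_pdivlMr // ltr_pdivrMr // !(mulrC _ eta) h1 h2.
    by rewrite -[X in measurable X]setTI; apply: mu => //; exact: measurable_itv.
  have maidx : measurable_fun [set: E] (fun x => a (idx x)).
    move=> _ B _; rewrite setTI.
    have -> : (fun x => a (idx x)) @^-1` B = \bigcup_(j in [set j | B (a j)]) (idx @^-1` [set j]).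
      apply/seteqP; split=> x /=; first by move=> h; exists (idx x).
      by move=> [j /= h ->].
    by apply: fin_bigcup_measurable.
  have ua x : u x <= a (idx x).
    by have /andP[_ /ltW] := u_itv x; rewrite mulrC.
  have au x : a (idx x) <= u x + eta.
    by rewrite /a -natr1 mulrDl mul1r lerD2r mulrC; have /andP[] := u_itv x.
  apply: (@le_trans _ _ (\int[P]_w (\prod_(i < m) a (idx (X i w)))%:E)%E).
    apply: ge0_le_integral => //.
    - by move=> w _; rewrite lee_fin prodr_ge0.
    - apply/measurable_EFinP/measurable_prod => i _.
      exact: measurable_comp_sample.
    - apply/measurable_EFinP/measurable_prod => i _.
      exact: (measurable_comp_sample (u := fun x => a (idx x))).
    - by move=> w _; rewrite lee_fin ler_prod // => i _; rewrite u0 ua.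
  rewrite expectation_prod_simple // lee_fin.
  have bue : bounded_measurable (fun x => u x + eta).
    split; first by apply: measurable_funD.
    exists (M + `|eta|) => x; apply: le_trans (ler_normD _ _) _.
    by rewrite lerD2r.
  have le1 : \sum_(j < q) a j * fine (D (idx @^-1` [set j])) <= I + eta.
    rewrite -lee_fin -(Rintegral_simple D midx a0).
    have -> : I + eta = \int[D]_x (u x + eta).
      rewrite RintegralD ?Rintegral_probability_cst //.
        exact: bounded_measurable_integrable.
      exact/bounded_measurable_integrable/bounded_measurable_cst.
    rewrite -EFin_Rintegral //; apply: ge0_le_integral => //.
    - by move=> x _; rewrite lee_fin.
    - exact/measurable_EFinP.
    - by apply/measurable_EFinP; case: bue.
    - by move=> x _; rewrite lee_fin.
  rewrite lerXn2r ?nnegrE // ?addr_ge0 // ?(ltW eta0) //.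
  by rewrite sumr_ge0 // => j _; rewrite mulr_ge0 // fine_ge0.
apply/lee_addgt0Pr => e e0.
have := @exprn_continuous R m I => /cvgrPdist_lt/(_ _ e0)[r /= r0 hr].
apply: (le_trans (approx (r / 2) _)); first by rewrite divr_gt0.
rewrite -EFinD lee_fin; have := hr (I + r / 2).
rewrite /ball /= opprD addNKr normrN gtr0_norm ?divr_gt0 //.
have hr2 : r / 2 < r by lra.
move=> /(_ hr2); rewrite ltr_norml; lra.
Qed.

(** Chernoff's method.  The centred variable is bounded by [c], so its moment
    generating function at [s] is at most [expR (s ^ 2 * c ^ 2)], and
    [s = t / (2 * c ^ 2)] minimizes [m * s ^ 2 * c ^ 2 - m * s * t]. *)
Lemma deviation_inequality (f : E -> R) (a c t : R) : (0 < m)%N ->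
  measurable_fun [set: E] f -> (forall x, a <= f x <= a + c) -> 0 < c -> 0 <= t ->
  (P [set w | (t <= \int[D]_x f x - m%:R^-1 * \sum_(j < m) f (X j w))%R]
    <= (expR (- (m%:R * t ^+ 2 / (4 * c ^+ 2))))%:E)%E.
Proof.
move=> m0 mf fac c0 t0; set mean := \int[D]_x f x.
have bf : bounded_measurable f.
  split=> //; exists (`|a| + `|c|) => x; have /andP[h1 h2] := fac x.
  rewrite ler_norml; have := ler_norm a; have := ler_norm c.
  have := ler_norm (- a); rewrite normrN; have := normr_ge0 c; lra.
have intf := bounded_measurable_integrable D bf.
have bcst b : D.-integrable [set: E] (EFin \o (fun=> b)).
  exact/bounded_measurable_integrable/bounded_measurable_cst.
have mean_itv : a <= mean <= a + c.
  rewrite -{1}(Rintegral_probability_cst D a) -(Rintegral_probability_cst D (a + c)).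
  by apply/andP; split; apply: (le_Rintegral measurableT) => // x _; have /andP[] := fac x.
pose s := t / (2 * c ^+ 2).
have s0 : 0 <= s by rewrite divr_ge0 // mulr_ge0 // sqr_ge0.
pose u x := expR (s * (mean - f x)).
have mu : measurable_fun [set: E] u.
  apply: (@measurableT_comp _ _ _ _ _ _ (@expR R)); first exact: measurable_expR.
  by apply: measurable_funM => //; apply: measurable_funB.
have bu : bounded_measurable u.
  split=> //; exists (expR (s * c)) => x; rewrite ger0_norm ?expR_ge0 // ler_expR.
  by rewrite ler_wpM2l //; have /andP[] := fac x; case/andP: mean_itv; lra.
have Iu : \int[D]_x u x <= expR (s ^+ 2 * c ^+ 2).
  pose g x := (s * mean + expR (s ^+ 2 * c ^+ 2)) - s * f x.
  have mg : measurable_fun [set: E] (fun x => s * f x) by apply: measurable_funM.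
  have bsf : bounded_measurable (fun x => s * f x).
    split => //; have [_ [M fM]] := bf; exists (s * M) => x.
    by rewrite normrM ger0_norm // ler_wpM2l.
  have -> : expR (s ^+ 2 * c ^+ 2) = \int[D]_x g x.
    rewrite RintegralB // ?Rintegral_probability_cst ?RintegralZl //; last first.
      exact: bounded_measurable_integrable.
    by rewrite -/mean; lra.
  apply: le_Rintegral => //.
  - exact: bounded_measurable_integrable.
  - apply: bounded_measurable_integrable; split; first by apply: measurable_funB.
    case: bsf => _ [M hM]; exists (`|s * mean + expR (s ^+ 2 * c ^+ 2)| + M) => x.
    by apply: (le_trans (ler_normB _ _)); rewrite lerD2l.
  move=> x _; apply: (le_trans (expR_le_add_expR_sqr _)).
  have : expR ((s * (mean - f x)) ^+ 2) <= expR (s ^+ 2 * c ^+ 2).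
    rewrite ler_expR exprMn ler_wpM2l ?sqr_ge0 //.
    rewrite -(real_normK (num_real (mean - f x))) lerXn2r ?nnegrE ?(ltW c0) //.
    by rewrite ler_norml; have /andP[] := fac x; case/andP: mean_itv; lra.
  rewrite /g; lra.
pose Y w := \prod_(i < m) u (X i w).
have mY : measurable_fun [set: T] Y.
  by apply: measurable_prod => i _; exact: measurable_comp_sample.
have YE w : Y w = expR (s * (m%:R * (mean - m%:R^-1 * \sum_(j < m) f (X j w)))).
  rewrite /Y -expR_sum; congr expR.
  rewrite -mulr_sumr sumrB sumr_const card_ord; congr (s * _).
  by rewrite mulrBr mulrA divff ?pnatr_eq0 ?lt0n_neq0 // mul1r mulr_natl.
pose b := expR (s * (m%:R * t)).
set B := [set w | _].
have mB : measurable B.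
  have -> : B = (fun w => mean - m%:R^-1 * \sum_(j < m) f (X j w)) @^-1` `[t, +oo[%classic.
    by apply/seteqP; split=> w /=; rewrite in_itv /= andbT.
  have mh : measurable_fun [set: T] (fun w => mean - m%:R^-1 * \sum_(j < m) f (X j w)).
    apply: measurable_funB => //; apply: measurable_funM => //.
    by apply: measurable_sum => j; exact: measurable_comp_sample.
  by rewrite -[X in measurable X]setTI; apply: mh => //; exact: measurable_itv.
have b0 : 0 < b by exact: expR_gt0.
have : (b%:E * P B <= ((\int[D]_x u x) ^+ m)%:E)%E.
  have u0 x : 0 <= u x by exact: expR_ge0.
  apply: le_trans (expectation_prod_le bu u0).
  rewrite -[X in P X]setIT -integral_indic // -ge0_integralZl_EFin ?(ltW b0) //; last first.
    by apply/measurable_EFinP; exact: measurable_indic.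
  apply: ge0_le_integral => //.
  - by move=> w _; rewrite mule_ge0 // lee_fin // ltW.
  - by apply/measurable_EFinP/measurable_funM => //; exact: measurable_indic.
  - exact/measurable_EFinP.
  move=> w _; rewrite -EFinM lee_fin indicE.
  have [wB|_] := boolP (w \in B); last by rewrite mulr0 prodr_ge0.
  rewrite mulr1 -/(Y w) YE ler_expR ler_wpM2l // ler_wpM2l //.
  by move: wB; rewrite inE.
rewrite -[P B]fineK ?fin_num_measure // -EFinM !lee_fin mulrC -ler_pdivlMr //.
move=> h; apply: (le_trans h).
rewrite ler_pdivrMr // -expRD.
apply: (@le_trans _ _ (expR (s ^+ 2 * c ^+ 2) ^+ m)).
  by rewrite lerXn2r ?nnegrE ?expR_ge0 // Rintegral_ge0 // => x _; exact: expR_ge0.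
rewrite -expRM_natl ler_expR le_eqVlt; apply/orP; left; apply/eqP.
by rewrite /s; field; rewrite gt_eqF.
Qed.

End IndependentSample.

(** * Chaining *)

Section Chaining.
Context {R : realType} {d d' : measure_display}.
Context {T : measurableType d} {E : measurableType d'}.
Variables (P : probability T R) (D : probability E R).
Variables (m : nat) (X : 'I_m -> {RV P >-> E}).
Hypothesis hX : iid_sample D X.
Hypothesis m_gt0 : (0 < m)%N.

Lemma union_bound (I : Type) (s : seq I) (A : I -> set T) (p : R) : 0 <= p ->
  (forall i, measurable (A i)) -> (forall i, (P (A i) <= p%:E)%E) ->
  (P (\big[setU/set0]_(i <- s) A i) <= ((size s)%:R * p)%:E)%E.
Proof.
move=> p0 mA hA; elim: s => [|i s IH]; first by rewrite big_nil measure0 mul0r.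
rewrite big_cons /= -natr1 mulrDl mul1r addrC EFinD.
apply: le_trans (leeD (hA i) IH).
by apply: measureU2 => //; apply: bigsetU_measurable.
Qed.

Definition deviation (f : E -> R) (w : T) : R :=
  \int[D]_x f x - m%:R^-1 * \sum_(j < m) f (X j w).

Lemma measurable_deviation f :
  measurable_fun [set: E] f -> measurable_fun [set: T] (deviation f).
Proof.
move=> mf; apply: measurable_funB => //; apply: measurable_funM => //.
by apply: measurable_sum => j; exact: (measurable_comp_sample X j).
Qed.

Lemma deviationB f g w : bounded_measurable f -> bounded_measurable g ->
  deviation (fun x => f x - g x) w = deviation f w - deviation g w.
Proof.
move=> bf bg; rewrite /deviation RintegralB //; try exact: bounded_measurable_integrable.
by rewrite sumrB mulrBr; lra.
Qed.

Lemma deviation_dist f g e w : bounded_measurable f -> bounded_measurable g ->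
  (forall x, `|f x - g x| <= e) -> deviation f w <= deviation g w + 2 * e.
Proof.
move=> bf bg fge; rewrite -subr_le0 opprD addrA -deviationB // /deviation.
have [Bf Bg] := (bounded_measurable_integrable D bf, bounded_measurable_integrable D bg).
have h1 : \int[D]_x (f x - g x) <= e.
  rewrite -(Rintegral_probability_cst D e).
  have mfg : measurable_fun [set: E] (fun x => f x - g x).
    by apply: measurable_funB; [case: bf | case: bg].
  apply: (le_Rintegral measurableT).
  - by apply: bounded_measurable_integrable; split=> //; exists e.
  - exact/bounded_measurable_integrable/bounded_measurable_cst.
  - by move=> x _; apply: le_trans (ler_norm _) _.
have h2 : - e <= m%:R^-1 * \sum_(j < m) (f (X j w) - g (X j w)).
  rewrite ler_pdivlMl ?ltr0n //.
  apply: (@le_trans _ _ (\sum_(j < m) (- e))).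
    by rewrite sumr_const card_ord mulrN mulr_natl mulNrn.
  by apply: ler_sum => j _; have := fge (X j w); rewrite ler_norml => /andP[].
lra.
Qed.

(** Let [v = ln V + ln (2 / delta)] and [tau ^ 2 = v / m].  Elements of [N 0] are
    allowed the deviation [4 * B * tau], and the link between an element of
    [N k] and a nearby element of [N (k - 1)] the deviation [B * tau / 2 ^ k].
    The scales shrink by a factor [4] per level and the allowances only by [2],
    so the exponent of the tail bound grows like [4 ^ k * v], whereas the
    logarithm of the number of links grows like [k * ln V]; hence level [k] fails
    with probability at most [delta / 2 ^ (k + 1)].  The allowances add up to
    [5 * B * tau].  Stopping at a level of scale below [r] keeps the union of bad
    events finite. *)
Lemma chaining_bound (I : eqType) (S : set I) (f : I -> E -> R) (N : nat -> seq I)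
    (B V delta r : R) :
  0 < B -> 1 <= V -> 0 < delta -> delta < 1 -> 0 < r ->
  (forall i, S i -> measurable_fun [set: E] (f i)) ->
  (forall i x, S i -> 0 <= f i x <= 2 * B) ->
  (forall k i, i \in N k -> S i) ->
  (forall k i, S i -> exists2 j, j \in N k &
     forall x, `|f i x - f j x| <= B / 16 / 4 ^+ k) ->
  (forall k, (size (N k))%:R <= V ^+ k.+1) ->
  exists G : set T, [/\ measurable G, ((1 - delta)%:E <= P G)%E &
    forall w i, G w -> S i ->
      deviation (f i) w <= 5 * B * Num.sqrt ((ln V + ln (2 / delta)) / m%:R) + r].
Proof.
move=> B0 V1 delta0 delta1 r0 mf fB NS net cardN.
have V0 : 0 < V by lra.
have d2 : 0 < 2 / delta by rewrite divr_gt0.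
set v := ln V + ln (2 / delta); set tau := Num.sqrt (v / m%:R).
have v0 : 0 <= v.
  by rewrite addr_ge0 ?ln_ge0 // ler_pdivlMr //; lra.
have m0 : (0 : R) < m%:R by rewrite ltr0n.
have tau0 : 0 <= tau by exact: sqrtr_ge0.
have tau2 : m%:R * tau ^+ 2 = v.
  by rewrite sqr_sqrtr ?divr_ge0 ?ler0n // mulrC divfK // gt_eqF.
have expv : expR (- v) = delta / 2 / V.
  rewrite expRN expRD !lnK ?posrE //; field.
  by rewrite !gt_eqF.
have bf i : S i -> bounded_measurable (f i).
  move=> Si; split; first exact: mf.
  exists (2 * B) => x; have /andP[h1 h2] := fB i x Si.
  by rewrite ger0_norm.
pose eps k : R := B / 16 / 4 ^+ k.
have eps0 k : 0 < eps k by rewrite !divr_gt0 // exprn_gt0.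
have /choice[pi hpi] : forall ki : nat * I, exists j, S ki.2 ->
    j \in N ki.1 /\ forall x, `|f ki.2 x - f j x| <= eps ki.1.
  move=> [k i]; have [/(net k)[j jN hj]|nS] := pselect (S i).
    by exists j.
  by exists i.
pose link k i x : R := if k is k'.+1 then f i x - f (pi (k', i)) x else f i x.
pose width k : R := if k is k'.+1 then 2 * eps k' else 2 * B.
pose t k := 2 * width k * 2 ^+ k * tau.
have width0 k : 0 < width k by case: k => [|k]; rewrite mulr_gt0.
have t0 k : 0 <= t k by rewrite !mulr_ge0 ?exprn_ge0 // ltW.
pose A k i : set T := if i \in N k then [set w | t k <= deviation (link k i) w] else set0.
have mlink k i : S i -> measurable_fun [set: E] (link k i).
  move=> Si; case: k => [|k] /=; first exact: mf.
  apply: measurable_funB; apply: mf => //.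
  by have [/NS] := hpi (k, i) Si.
have mA k i : measurable (A k i).
  rewrite /A; case: ifPn => // /NS Si.
  have -> : [set w | t k <= deviation (link k i) w]
      = deviation (link k i) @^-1` `[t k, +oo[%classic.
    by apply/seteqP; split=> w /=; rewrite in_itv /= andbT.
  rewrite -[X in measurable X]setTI; apply: measurable_deviation => //.
  exact: mlink.
have PA k i : (P (A k i) <= (expR (- v) ^+ k.+1)%:E)%E.
  rewrite /A; case: ifPn => [/NS Si|_]; last by rewrite measure0 lee_fin exprn_ge0 ?expR_ge0.
  have [a ha] : exists a, forall x, a <= link k i x <= a + width k.
    case: k => [|k] /=; first by exists 0 => x; rewrite add0r fB.
    exists (- eps k) => x; have [_ /(_ x)] := hpi (k, i) Si.
    by rewrite ler_norml /=; lra.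
  apply: le_trans (deviation_inequality hX m_gt0 (mlink k i Si) ha (width0 k) (t0 k)) _.
  rewrite lee_fin -expRM_natl ler_expR mulrN lerN2.
  have -> : m%:R * t k ^+ 2 / (4 * width k ^+ 2) = (2 ^+ k) ^+ 2 * v.
    by rewrite -tau2 /t; field; rewrite gt_eqF.
  rewrite ler_wpM2r // -exprM mulnC -natrX ler_nat expnM.
  exact: ltn_expl.
have [K hK] : exists K, 2 * eps K <= r.
  exists (Num.truncn (B / r)); rewrite /eps; set K := Num.truncn _.
  have h1 : B / r < K.+1%:R by exact: truncnS_gt.
  have h2 : K.+1%:R <= (4 : R) ^+ K by rewrite -natrX ler_nat ltn_expl.
  have h3 : B / r < 4 ^+ K by exact: lt_le_trans h1 h2.
  rewrite mulrA ler_pdivrMr ?exprn_gt0 //.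
  by move: h3; rewrite ltr_pdivrMr // [r * _]mulrC; lra.
pose bad := \big[setU/set0]_(k < K.+1) \big[setU/set0]_(i <- N k) A k i.
have mbad : measurable bad.
  by apply: bigsetU_measurable => k _; apply: bigsetU_measurable.
have Pbad : (P bad <= delta%:E)%E.
  have level k : (P (\big[setU/set0]_(i <- N k) A k i) <= (delta / 2 ^+ k.+1)%:E)%E.
    apply: (le_trans (union_bound _ _ (mA k) (PA k))).
      by rewrite exprn_ge0 ?expR_ge0.
    rewrite lee_fin.
    apply: (@le_trans _ _ (V ^+ k.+1 * expR (- v) ^+ k.+1)).
      by rewrite ler_wpM2r ?exprn_ge0 ?expR_ge0.
    rewrite -exprMn expv mulrC divfK ?gt_eqF // expr_div_n ler_pM2r ?invr_gt0 ?exprn_gt0 //.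
    by rewrite exprS ler_piMr ?(ltW delta0) // exprn_ile1 // ltW.
  have partial n : (P (\big[setU/set0]_(k < n) \big[setU/set0]_(i <- N k) A k i)
      <= (delta - delta / 2 ^+ n)%:E)%E.
    elim: n => [|n IH]; first by rewrite big_ord0 measure0 expr0 divr1 subrr.
    rewrite big_ord_recr /=.
    have -> : delta - delta / 2 ^+ n.+1
        = (delta - delta / 2 ^+ n) + delta / 2 ^+ n.+1.
      by rewrite exprS; field; rewrite expf_neq0.
    rewrite EFinD; apply: le_trans (leeD IH (level n)).
    apply: measureU2; apply: bigsetU_measurable => // k _.
    exact: bigsetU_measurable.
  apply: (le_trans (partial K.+1)).
  by rewrite lee_fin gerBl divr_ge0 ?exprn_ge0 // ltW.
exists (~` bad); split; first exact: measurableC.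
  by rewrite probability_setC // EFinB leeB.
move=> w i nbad Si.
have good k j : (k <= K)%N -> j \in N k -> deviation (link k j) w < t k.
  move=> kK jN; rewrite ltNge; apply/negP => tle; apply: nbad.
  rewrite /bad -(bigcup_mkord _ (fun k => \big[setU/set0]_(i <- N k) A k i)).
  exists k; first by rewrite /= ltnS.
  rewrite (perm_big _ (perm_to_rem jN)) big_cons; left.
  by rewrite /A jN.
(* The constant is the sum of the allowances up to level [k]. *)
have chain k j : (k <= K)%N -> j \in N k ->
    deviation (f j) w <= (5 - 1 / 2 ^+ k) * (B * tau).
  elim: k j => [|k IH] j kK jN.
    by have := good 0%N j kK jN; rewrite /t /link /= expr0; lra.
  have := good k.+1 j kK jN; have Sj := NS _ _ jN.
  have [piN _] := hpi (k, j) Sj.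
  rewrite [deviation _ _]deviationB; [|exact: bf|by apply: bf; exact: NS piN].
  have := IH _ (ltnW kK) piN.
  have -> : t k.+1 = (1 / 2 ^+ k - 1 / 2 ^+ k.+1) * (B * tau).
    have -> : t k.+1 = 4 * eps k * 2 ^+ k.+1 * tau by rewrite /t /=; lra.
    have e4 : 4 ^+ k = (2 ^+ k) ^+ 2 :> R by rewrite -exprM mulnC exprM; congr (_ ^+ k); lra.
    rewrite /eps e4 (exprS _ k); field.
    by rewrite expf_neq0.
  lra.
have [j jN hj] := net K i Si.
have := deviation_dist w (bf _ Si) (bf _ (NS _ _ jN)) hj.
have := chain K j (leqnn K) jN.
have : 0 <= 1 / 2 ^+ K * (B * tau).
  by rewrite mulr_ge0 ?divr_ge0 ?exprn_ge0 // mulr_ge0 // ltW.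
move: hK; rewrite /eps; lra.
Qed.

End Chaining.

(** * The loss class of the network *)

Section BorelColumn.
Variables (R : realType) (N : nat).

Lemma lipschitz_measurable (g : 'cV[R]_N -> R) (C : R) : 0 <= C ->
  (forall x y, `|g x - g y| <= C * l2norm (x - y)) ->
  measurable_fun [set: borel_cV R N] (g : borel_cV R N -> R).
Proof.
move=> C0 gC.
have cg : continuous g.
  move=> x; apply/(@cvgrPdist_lt _ _ _ (nbhs x)) => e e0.
  pose r := e / (C * N%:R + 1).
  have CN0 : 0 < C * N%:R + 1 by rewrite ltr_wpDl ?mulr_ge0.
  have r0 : 0 < r by rewrite divr_gt0.
  apply/nbhs_ballP; exists r => //= y xy.
  apply: (le_lt_trans (gC x y)).
  have : l2norm (x - y) <= N%:R * r.
    apply: (le_trans (l2norm_le_sum _)).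
    apply: (@le_trans _ _ (\sum_(i < N) r)); last by rewrite sumr_const card_ord mulr_natl.
    by apply: ler_sum => i _; rewrite !mxE; case: xy => _ /(_ i 0); rewrite /ball /= => /ltW.
  move=> /(ler_wpM2l C0)/le_lt_trans; apply.
  have -> : C * (N%:R * r) = e * (C * N%:R / (C * N%:R + 1)).
    by rewrite /r; field; rewrite gt_eqF.
  by rewrite gtr_pMr // ltr_pdivrMr // mul1r ltrDl.
move=> mD; apply: (measurability _ (RGenOInfty.measurableE R)) => //.
move=> _ [_ [a ->] <-]; rewrite setTI; apply: sub_sigma_algebra.
have /continuousP := cg; apply; exact: interval_open.
Qed.

End BorelColumn.

Section LossClass.
Variables (R : realType) (n N m L : nat).
Hypothesis L_gt0 : (0 < L)%N.
Hypothesis m_gt0 : (0 < m)%N.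
Variables (A : 'M[R]_(n, N)) (tau lambda : R).
Hypotheses (tau_ge0 : 0 <= tau) (lambda_ge0 : 0 <= lambda).
Hypothesis tauA : tau * spectral_norm A ^+ 2 <= 1.
Variable B : R.
Hypothesis B_gt0 : 0 < B.
Local Notation loss_at := (net_loss A tau lambda B L).
Local Notation E := (borel_cV R N).

Let B_ge0 : 0 <= B := ltW B_gt0.
Let K : R := (L * L.+1)%:R.

Let K_gt0 : 0 < K. Proof. by rewrite ltr0n muln_gt0 L_gt0. Qed.

(** Projecting the signal first makes the loss bounded by [2 * B] everywhere
    and changes nothing almost surely. *)
Definition truncated_loss Phi (x : E) : R := loss_at Phi (ball_proj B x).

Lemma truncated_loss_itv Phi x : 0 <= truncated_loss Phi x <= 2 * B.
Proof. by rewrite net_loss_ge0 net_loss_le ?l2norm_ball_proj. Qed.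

Lemma measurable_net_loss Phi : orthogonal_group R N Phi ->
  measurable_fun [set: E] (loss_at Phi : E -> R).
Proof.
move=> hPhi; apply: (@lipschitz_measurable _ _ _ L.+1%:R) => // x y.
exact: net_loss_lipschitz_signal.
Qed.

Lemma measurable_truncated_loss Phi : orthogonal_group R N Phi ->
  measurable_fun [set: E] (truncated_loss Phi).
Proof.
move=> hPhi; apply: (@lipschitz_measurable _ _ _ L.+1%:R) => // x y.
apply: (le_trans (net_loss_lipschitz_signal _ _ _ _ _ _ _ hPhi)) => //.
by rewrite ler_wpM2l // ball_proj_nonexpansive.
Qed.

Lemma truncated_loss_dist Phi Psi x :
  orthogonal_group R N Phi -> orthogonal_group R N Psi ->
  `|truncated_loss Phi x - truncated_loss Psi x| <= K * spectral_norm (Phi - Psi) * B.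
Proof.
move=> hPhi hPsi.
apply: (le_trans (net_loss_lipschitz_basis _ _ _ _ _ _ hPhi hPsi)) => //.
by rewrite ler_wpM2l ?l2norm_ball_proj // mulr_ge0 ?spectral_norm_ge0 // ltW.
Qed.

(** At this distance of the bases, losses differ by at most [B / (16 * 4 ^ k)]. *)
Definition basis_scale (k : nat) : R := (16 * K * 4 ^+ k)^-1.

Lemma basis_scale_gt0 k : 0 < basis_scale k.
Proof. by rewrite invr_gt0 !mulr_gt0 // exprn_gt0. Qed.

Lemma basis_scaleE k : K * basis_scale k = 1 / 16 / 4 ^+ k.
Proof.
rewrite /basis_scale; move: K_gt0; move: (K) => kk kk0.
by field; rewrite !gt_eqF // exprn_gt0.
Qed.

Definition covering_base : R := (1 + 48 * K) ^+ (N * N).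

Lemma orthogonal_nets : exists s : nat -> seq 'M[R]_N,
  [/\ forall k Phi, Phi \in s k -> orthogonal_group R N Phi,
      forall k Phi, orthogonal_group R N Phi ->
        exists2 Psi, Psi \in s k & spectral_norm (Phi - Psi) <= basis_scale k
    & forall k, (size (s k))%:R <= covering_base ^+ k.+1].
Proof.
have h k := finite_net (basis_scale_gt0 k) (@spectral_norm_orthogonal R N).
have [s hs] := choice h; exists s; split=> k; have [h1 h2 h3] := hs k => //.
apply: (le_trans h3).
rewrite /covering_base exprAC.
have e0 : 0 <= 1 + 48 * K by rewrite addr_ge0 // mulr_ge0 // ltW.
rewrite lerXn2r ?nnegrE ?exprn_ge0 //.
  by rewrite addr_ge0 // divr_ge0 // ltW // basis_scale_gt0.
rewrite /basis_scale invrK exprS.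
have K1 : 1 <= K by rewrite ler1n muln_gt0 L_gt0.
have le4 : 4 ^+ k <= (1 + 48 * K) ^+ k by rewrite lerXn2r ?nnegrE //; lra.
apply: (@le_trans _ _ ((1 + 48 * K) * 4 ^+ k)); last by rewrite ler_wpM2l.
have : (1 : R) <= 4 ^+ k by rewrite exprn_ege1 //; lra.
lra.
Qed.

Section Sample.
Variables (d : measure_display) (T : measurableType d) (P : probability T R).
Variables (D : probability E R) (X : 'I_m -> {RV P >-> E}).
Hypothesis hX : iid_sample D X.
Hypothesis hbound : forall i, {ae P, forall w, l2norm (X i w) <= B}.

Definition outside : set E := [set x : E | B < l2norm (x : 'cV[R]_N)].

Lemma measurable_outside : measurable outside.
Proof.
have ml : measurable_fun [set: E] (fun x : E => l2norm (x : 'cV[R]_N)).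
  apply: (@lipschitz_measurable _ _ _ 1) => // x y.
  by rewrite mul1r l2norm_dist_dist.
have -> : outside = (fun x : E => l2norm (x : 'cV[R]_N)) @^-1` `]B, +oo[%classic.
  by apply/seteqP; split=> x /=; rewrite in_itv /= andbT.
by rewrite -[X in measurable X]setTI; apply: ml => //; exact: measurable_itv.
Qed.

Lemma sample_outside i : P (X i @^-1` outside) = 0.
Proof.
have [U [mU PU0 UP]] := hbound i.
apply/eqP; rewrite eq_le measure_ge0 andbT -PU0.
apply: le_measure; rewrite ?inE //.
  by rewrite -[X in measurable X]setTI; apply: measurable_funP => //; exact: measurable_outside.
by move=> w /= hw; apply: UP => /=; apply/negP; rewrite -ltNge.
Qed.

Lemma distribution_outside : D outside = 0.
Proof.
case: hX => hD _; rewrite -(hD (Ordinal m_gt0)); last exact: measurable_outside.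
exact: sample_outside.
Qed.

Lemma true_lossE Phi : orthogonal_group R N Phi ->
  true_loss A D (network A tau lambda B L Phi) = (\int[D]_x truncated_loss Phi x)%:E.
Proof.
move=> hPhi; rewrite -EFin_Rintegral; last first.
  split; first exact: measurable_truncated_loss.
  exists (2 * B) => x; have /andP[h1 h2] := truncated_loss_itv Phi x.
  by rewrite ger0_norm.
rewrite /true_loss unlock; apply: ae_eq_integral => //.
- by apply/measurable_EFinP; exact: measurable_net_loss.
- by apply/measurable_EFinP; exact: measurable_truncated_loss.
exists outside; split; [exact: measurable_outside|exact: distribution_outside|].
move=> x /= hx; rewrite /outside /= ltNge; apply/negP => xB; apply: hx => _.
by rewrite /truncated_loss ball_proj_id.
Qed.

Definition sample_loss Phi w : R := m%:R^-1 * \sum_(j < m) loss_at Phi (X j w).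

(** The event is an intersection over uncountably many bases, but both sides of
    the inequality are continuous in the basis, so the countable union of the
    nets defines the same event. *)
Lemma measurable_uniform_bound (c : R) :
  measurable [set w : T | forall Phi, orthogonal_group R N Phi ->
    \int[D]_x truncated_loss Phi x <= sample_loss Phi w + c].
Proof.
have arith (a b p q x y : R) : a <= b + q -> q + p <= y -> a + x + p <= b + x + y.
  by move=> h1 h2; lra.
have [s [sO snet _]] := orthogonal_nets.
pose G Psi := [set w : T | \int[D]_x truncated_loss Psi x <= sample_loss Psi w + c].
have mG Psi : orthogonal_group R N Psi -> measurable (G Psi).
  move=> hPsi.
  have ms : measurable_fun [set: T] (sample_loss Psi).
    apply: measurable_funM => //; apply: measurable_sum => j.
    apply: (measurable_comp_sample X j (u := loss_at Psi : E -> R)).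
    exact: measurable_net_loss.
  have -> : G Psi = sample_loss Psi @^-1` `[\int[D]_x truncated_loss Psi x - c, +oo[%classic.
    by apply/seteqP; split=> w; rewrite /G /= in_itv /= andbT lerBlDr.
  by rewrite -[X in measurable X]setTI; apply: ms => //; exact: measurable_itv.
set S := [set w : T | _].
have -> : S = \bigcap_k \bigcap_(Psi in [set` s k]) G Psi.
  apply/seteqP; split=> w /=; first by move=> h k _ Psi /= /sO; exact: h.
  move=> h Phi hPhi; apply/ler_addgt0Pr => e e0.
  pose M := m%:R^-1 * \sum_(j < m) l2norm (X j w : 'cV[R]_N) + B.
  have M0 : 0 < M.
    by rewrite ltr_wpDl // mulr_ge0 ?invr_ge0 // sumr_ge0 // => j _; exact: l2norm_ge0.
  have [k h1] : exists k : nat, M / e < k.+1%:R.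
    by exists (Num.truncn (M / e)); exact: truncnS_gt.
  have Mk : K * basis_scale k * M <= e.
    have h2 : k.+1%:R <= (4 : R) ^+ k by rewrite -natrX ler_nat ltn_expl.
    have h4 : (0 : R) < 4 ^+ k by exact: exprn_gt0.
    rewrite basis_scaleE mulrAC mul1r.
    rewrite ler_pdivrMr //.
    have := lt_le_trans h1 h2; rewrite ltr_pdivrMr // [_ * e]mulrC.
    by lra.
  have [Psi Psis hd] := snet k Phi hPhi.
  have hPsi := sO _ _ Psis.
  have hw : G Psi w by exact: h Psis.
  have Kd : K * spectral_norm (Phi - Psi) <= K * basis_scale k by rewrite ler_wpM2l // ltW.
  have d1 : \int[D]_x truncated_loss Phi x
      <= \int[D]_x truncated_loss Psi x + K * basis_scale k * B.
    have bt Th : orthogonal_group R N Th -> bounded_measurable (truncated_loss Th).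
      move=> hTh; split; first exact: measurable_truncated_loss.
      exists (2 * B) => x; have /andP[a1 a2] := truncated_loss_itv Th x.
      by rewrite ger0_norm.
    have bc := bounded_measurable_integrable D
      (bounded_measurable_cst (E := E) (K * basis_scale k * B)).
    have [iPhi iPsi] := (bounded_measurable_integrable D (bt _ hPhi),
                         bounded_measurable_integrable D (bt _ hPsi)).
    rewrite -(Rintegral_probability_cst D (K * basis_scale k * B)) -RintegralD //.
    apply: (le_Rintegral measurableT) => //.
      by have := integrableD measurableT iPsi bc.
    move=> x _; apply: ler_distlDr.
    exact: le_trans (truncated_loss_dist x hPhi hPsi) (ler_wpM2r B_ge0 Kd).
  have d2 : sample_loss Psi w <= sample_loss Phi w
      + K * basis_scale k * (m%:R^-1 * \sum_(j < m) l2norm (X j w : 'cV[R]_N)).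
    rewrite /sample_loss mulrCA -mulrDr ler_wpM2l ?invr_ge0 // mulr_sumr -big_split /=.
    apply: ler_sum => j _; apply: ler_distlCDr.
    apply: le_trans (ler_wpM2r (l2norm_ge0 (X j w : 'cV[R]_N)) Kd).
    exact: net_loss_lipschitz_basis.
  apply: (le_trans d1); apply: (le_trans (lerD hw (lexx _))).
  by move: Mk; rewrite /M mulrDr; exact: arith.
apply: bigcapT_measurable => k; apply: fin_bigcap_measurable => //.
by move=> Psi /= /sO; exact: mG.
Qed.

(** Off a null event the truncated losses agree with the losses, so the chaining
    bound applies to the latter. *)
Lemma uniform_deviation (delta c : R) : 0 < delta -> delta < 1 ->
  5 * B * Num.sqrt ((ln covering_base + ln (2 / delta)) / m%:R) < c ->
  ((1 - delta)%:E <= P [set w : T | forall Phi, orthogonal_group R N Phi ->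
    (\int[D]_x truncated_loss Phi x <= sample_loss Phi w + c)%R])%E.
Proof.
move=> delta0 delta1 hc; set S := [set w : T | _].
have mS : measurable S by exact: measurable_uniform_bound.
have [s [sO snet scard]] := orthogonal_nets.
have V1 : 1 <= covering_base.
  by rewrite exprn_ege1 // lerDl mulr_ge0 // ltW.
have r0 : 0 < c - 5 * B * Num.sqrt ((ln covering_base + ln (2 / delta)) / m%:R).
  by rewrite subr_gt0.
have [] := @chaining_bound _ _ _ _ _ P D m X hX m_gt0 _ (orthogonal_group R N)
  truncated_loss s B covering_base delta _ B_gt0 V1 delta0 delta1 r0.
- exact: measurable_truncated_loss.
- by move=> Phi x _; exact: truncated_loss_itv.
- exact: sO.
- move=> k Phi hPhi; have [Psi Psis hd] := snet k Phi hPhi; exists Psi => // x.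
  apply: (le_trans (truncated_loss_dist x hPhi (sO _ _ Psis))).
  have -> : B / 16 / 4 ^+ k = K * basis_scale k * B by rewrite basis_scaleE; ring.
  by rewrite ler_wpM2r // ler_wpM2l // ltW.
- exact: scard.
move=> G [mG PG hG]; apply: (le_trans PG).
pose Z := \big[setU/set0]_(i <- enum 'I_m) (X i @^-1` outside).
have mX i : measurable (X i @^-1` outside).
  by rewrite -[X in measurable X]setTI; apply: measurable_funP => //; exact: measurable_outside.
have mZ : measurable Z by apply: bigsetU_measurable.
have PZ : (P Z <= 0)%E.
  have := @union_bound _ _ _ P _ (enum 'I_m) (fun i => X i @^-1` outside) 0 (lexx _) mX.
  by rewrite mulr0; apply => i; rewrite sample_outside.
have GS : G `<=` S `|` Z.
  move=> w Gw; have [Zw|nZ] := pselect (Z w); [by right|left] => Phi hPhi.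
  have := hG w Phi Gw hPhi; rewrite /deviation.
  have -> : \sum_(j < m) truncated_loss Phi (X j w) = \sum_(j < m) loss_at Phi (X j w).
    apply: eq_bigr => j _; rewrite /truncated_loss ball_proj_id // leNgt.
    apply/negP => hj; apply: nZ.
    have jm : j \in enum 'I_m by rewrite mem_enum.
    by rewrite /Z (perm_big _ (perm_to_rem jm)) big_cons; left.
  by rewrite -/(sample_loss Phi w); lra.
apply: (le_trans (le_measure P _ _ GS)); rewrite ?inE //; first exact: measurableU.
apply: (le_trans (measureU2 _ mS mZ)).
by rewrite -[leRHS]adde0 leeD2l.
Qed.

End Sample.

(** The entropy [N ^ 2 * ln (1 + 48 * L * (L + 1))] of the chaining bound is at
    most twice [N ^ 2 * ln (e + 8 * e * L)], because [(e + 8 * e * L) ^ 2]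
    dominates the quadratic polynomial in [L]; the factor is absorbed by
    [5 * sqrt 2 < 8].  The two terms under the root separate by squaring. *)
Lemma numeric_bound (delta : R) : 0 < delta -> delta < 1 ->
  5 * B * Num.sqrt ((ln covering_base + ln (2 / delta)) / m%:R)
    < 8 * B * (N%:R * Num.sqrt (ln (expR 1 + 8 * expR 1 * L%:R)) / Num.sqrt m%:R)
      + B * Num.sqrt (128 * ln (4 / delta) / m%:R).
Proof.
move=> delta0 delta1.
have m0 : (0 : R) < m%:R by rewrite ltr0n.
have sm0 : 0 < Num.sqrt (m%:R : R) by rewrite sqrtr_gt0.
have sqrt_div a : 0 <= a -> Num.sqrt (a / m%:R) = Num.sqrt a / Num.sqrt m%:R :> R.
  by move=> a0; rewrite sqrtrM // sqrtrV // ltW.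
have e2 : 2 <= expR 1 :> R by have := expR_ge1Dx (1 : R); lra.
have L0 : 0 <= L%:R :> R by [].
have KE : K = L%:R * (L%:R + 1) by rewrite /K natrM natr1.
have K0 := ltW K_gt0.
set b := ln (expR 1 + 8 * expR 1 * L%:R).
set a := ln (1 + 48 * K); set u := ln (4 / delta).
have a0 : 0 <= a by rewrite ln_ge0 // lerDl mulr_ge0.
have ab : a <= 2 * b.
  have p0 : 0 < expR 1 + 8 * expR 1 * L%:R :> R.
    by rewrite ltr_pwDl ?mulr_ge0 ?expR_ge0 // expR_gt0.
  rewrite -[2 * b]/(2%:R * b) mulr_natl -lnXn // ler_ln ?posrE ?exprn_gt0 //; last first.
    by rewrite ltr_pwDl // mulr_ge0.
  apply: (@le_trans _ _ ((2 + 16 * L%:R) ^+ 2)).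
    by rewrite KE; have := mulr_ge0 L0 L0; lra.
  rewrite lerXn2r ?nnegrE ?(ltW p0) ?addr_ge0 ?mulr_ge0 //.
  by have := ler_wpM2r L0 e2; lra.
have u0 : 0 < u by rewrite ln_gt0 // ltr_pdivlMr //; lra.
have lu : ln (2 / delta) <= u.
  by rewrite ler_ln ?posrE ?divr_gt0 // ler_pM2r ?invr_gt0 // ler_nat.
have l0 : 0 <= ln (2 / delta) by rewrite ln_ge0 // ler_pdivlMr //; lra.
have -> : ln covering_base = N%:R ^+ 2 * a.
  rewrite /covering_base lnXn; first by rewrite -[LHS]mulr_natl natrM expr2.
  by rewrite ltr_pwDl // mulr_ge0.
have b0 : 0 <= b by lra.
rewrite !sqrt_div ?addr_ge0 ?mulr_ge0 ?(ltW u0) ?sqr_ge0 //.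
have -> x y : 8 * B * (x / Num.sqrt m%:R) + B * (y / Num.sqrt m%:R)
    = B * (8 * x + y) / Num.sqrt m%:R by field; rewrite gt_eqF.
rewrite mulrA ltr_pM2r ?invr_gt0 // [5 * B]mulrC -mulrA ltr_pM2l //.
set p := N%:R * Num.sqrt b; set q := Num.sqrt (128 * u).
have p0 : 0 <= p by rewrite mulr_ge0 ?sqrtr_ge0.
have q0 : 0 < q by rewrite sqrtr_gt0 mulr_gt0.
have p2 : p ^+ 2 = N%:R ^+ 2 * b by rewrite exprMn sqr_sqrtr.
have q2 : q ^+ 2 = 128 * u by rewrite sqr_sqrtr // mulr_ge0 // ltW.
rewrite -(ltr_pXn2r (n := 2)) ?nnegrE ?mulr_ge0 ?sqrtr_ge0 ?addr_ge0 ?(ltW q0) //; last first.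
  by rewrite mulr_ge0.
rewrite exprMn sqr_sqrtr ?addr_ge0 ?mulr_ge0 ?sqr_ge0 //.
have := ler_wpM2l (sqr_ge0 (N%:R : R)) ab.
have := mulr_ge0 p0 (ltW q0); have := mulr_ge0 (sqr_ge0 (N%:R : R)) b0.
have -> : (8 * p + q) ^+ 2 = 64 * p ^+ 2 + 16 * (p * q) + q ^+ 2 by ring.
by rewrite p2 q2; lra.
Qed.

End LossClass.

Unset Implicit Arguments.

Theorem theorem2 (R : realType) (N n m L : nat)
    (hN : (1 <= N)%N) (hn : (1 <= n)%N) (hm : (1 <= m)%N) (hL : (1 <= L)%N)
    (A : 'M[R]_(n, N)) (tau lambda : R)
    (htau : 0 < tau) (hlambda : 0 < lambda)
    (htauA : tau * spectral_norm A ^+ 2 <= 1)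
    (Bin Bout : R) (hB : Bin = Bout) (hBout : 0 < Bout)
    (d : measure_display) (T : measurableType d) (P : probability T R)
    (D : probability (borel_cV R N) R)
    (X : 'I_m -> {RV P >-> borel_cV R N})
    (hX : iid_sample D X)
    (hbound : forall i, {ae P, forall w, l2norm (X i w) <= Bin})
    (delta : R) (hdelta0 : 0 < delta) (hdelta1 : delta < 1) :
  let good := [set w : T |
    forall h : 'cV[R]_n -> 'cV[R]_N, hypothesis_space A tau lambda Bout L h ->
      (true_loss A D h <=
        (empirical_loss (fun j => X j w) (fun j => A *m (X j w : 'cV[R]_N)) h
         + 8 * Bout
             * Num.sqrt (N%:R * n%:R * ln (2 + 8 * L%:R * (L%:R + 3)) / m%:R)
         + 8 * Bout * (N%:R * Num.sqrt (ln (expR 1 + 8 * expR 1 * L%:R))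
                       / Num.sqrt m%:R)
         + Bout * Num.sqrt (128 * ln (4 / delta) / m%:R))%:E)%E] in
  measurable good /\ ((1 - delta)%:E <= P good)%E.
Proof.
move=> good; subst Bin.
have [tau0 lambda0] := (ltW htau, ltW hlambda).
set c1 := 8 * Bout * Num.sqrt (N%:R * n%:R * ln (2 + 8 * L%:R * (L%:R + 3)) / m%:R) in good *.
set c2 := 8 * Bout * (N%:R * _ / _) in good *.
set c3 := Bout * Num.sqrt (128 * ln (4 / delta) / m%:R) in good *.
have goodE : good = [set w : T | forall Phi, orthogonal_group R N Phi ->
    \int[D]_x truncated_loss L A tau lambda Bout Phi x
      <= sample_loss L A tau lambda Bout X Phi w + (c1 + c2 + c3)].
  apply/seteqP; split=> w /= hw.
    move=> Phi hPhi; have := hw _ (ex_intro2 _ _ Phi hPhi erefl).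
    rewrite (true_lossE L hm tau0 lambda0 htauA hBout hX hbound hPhi) lee_fin.
    by rewrite !addrA.
  move=> _ [Phi hPhi <-].
  rewrite (true_lossE L hm tau0 lambda0 htauA hBout hX hbound hPhi) lee_fin.
  by have := hw Phi hPhi; rewrite !addrA.
rewrite goodE; split.
  exact: (measurable_uniform_bound hL tau0 lambda0 htauA hBout).
apply: (uniform_deviation hL hm tau0 lambda0 htauA hBout hX hbound hdelta0 hdelta1).
apply: (lt_le_trans (numeric_bound N hL hm hBout hdelta0 hdelta1)).
rewrite -/c2 -/c3 -addrA lerDr.
by rewrite mulr_ge0 ?sqrtr_ge0 // mulr_ge0 // ltW.
Qed.
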